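(* Let $n\ge1$, let $X_0\sim\mathcal N(\mu_0,\sigma_0^2)$ and, independently, $X_1,\dots,X_n$ i.i.d. $\mathcal N(\mu,\sigma^2)$, with $\mu_0,\mu\in\mathbb R$, $\sigma_0,\sigma\in(0,\infty)$; put $\delta:=(\mu-\mu_0)/\sigma_0$, $\rho:=\sigma/\sigma_0$, and let $R_i:=\sum_{j=0}^n\mathbf 1_{\{X_j\le X_i\}}$ for $0\le i\le n$. Let $1\le m\le n$. (i) Fix $1\le i_1<i_2<\cdots<i_m\le n$ and write $\mathbf R_{0,\mathbf i}:=(R_0,R_{i_1},\dots,R_{i_m})$. (ii) Let $\mathbf U_{n,m}\sim\mathrm{Uniform}(\mathcal S_{n,m})$ and $\xi\sim\mathrm{Bernoulli}(\Phi(-\delta))$ be independent, and write $\boldsymbol\xi_m:=(\xi,\xi,\dots,\xi)\in\{\mathbf 0_m,\mathbf 1_m\}$. (iii) Let $\boldsymbol\Upsilon_m\sim\mathrm{Uniform}(0,1)^m$ and $Z_{\rho,\delta}:=\Phi((X_0-\mu)/\sigma)$ be independent. Then the following convergences in distribution hold: 1. $\mathbf R_{0,\mathbf i}\Longrightarrow(n+1,\,\mathbf U_{n,m})$ as $\delta\to-\infty$; 2. $\mathbf R_{0,\mathbf i}\Longrightarrow(1+n\xi,\,\mathbf 1_m-\boldsymbol\xi_m+\mathbf U_{n,m})$ as $\rho\to0^+$; 3. $\mathbf R_{0,\mathbf i}\Longrightarrow(1,\,\mathbf 1_m+\mathbf U_{n,m})$ as $\delta\to\infty$; 4. $\mathbf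 R_{0,\mathbf i}\Longrightarrow\mathbf V_{1/2}$ as $\rho\to\infty$; 5. $\mathbf R_{0,\mathbf i}\Longrightarrow\mathbf V_{\Phi(-r)}$ as $\rho,|\delta|\to\infty$ with $\delta/\rho=r$ fixed; 6. $\frac1n(\mathbf R_{0,\mathbf i}-\mathbf 1_{m+1})\Longrightarrow(Z_{\rho,\delta},\,\boldsymbol\Upsilon_m)$ as $n\to\infty$ with $m$ fixed.
   Context: $\Phi$ is the standard normal CDF and $\Longrightarrow$ denotes convergence in distribution. $\mathbf 0_k$ and $\mathbf 1_k$ are the $k$-dimensional vectors of zeros and ones. $[n]:=\{1,\dots,n\}$. For $1\le m\le n$, $\mathcal S_{n,m}:=\{\mathbf j\in[n]^m: j_1,\dots,j_m\text{ all distinct}\}$, with cardinality $\prod_{i=1}^m(n-i+1)$. For $0<z<1$, $\mathbf V_z$ is the random vector in $\mathcal S_{n+1,m+1}$ with mass function $$\Pr(\mathbf V_z=\mathbf v)=\frac{\binom{n}{v_0-1}z^{v_0-1}(1-z)^{n+1-v_0}}{\prod_{i=1}^m(n-i+1)},\qquad \mathbf v=(v_0,v_1,\dots,v_m)\in\mathcal S_{n+1,m+1}.$$ $\mathrm{Uniform}(0,1)^m$ is the law of $m$ i.i.d. uniform variables on $(0,1)$. $Z_{\rho,\delta}$ has CDF $y\mapsto\Phi(\delta+\rho\,\Phi^{-1}(y))$ on $(0,1)$. The laws of the ranks depend on $\mu_0,\sigma_0,\mu,\sigma$ only through $(\rho,\delta)$. In each limit, the parameters among $n,\rho,\delta$ not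 sent to a limit are held fixed. *)

(* Defs.v *)
From HB Require Import structures.
From mathcomp Require Import all_boot all_order all_algebra.
From mathcomp Require Import finmap.
From mathcomp Require Import all_classical all_reals all_analysis.
Import Order.TTheory GRing.Theory Num.Theory.
Import numFieldNormedType.Exports.

Set Implicit Arguments.
Unset Strict Implicit.
Unset Printing Implicit Defensive.

Local Open Scope classical_set_scope.
Local Open Scope ring_scope.

(* The equality is required on measurable sets only: the two sides need not
   agree elsewhere. *)
Definition has_law (R : realType) (d d' : measure_display)
    (Om : measurableType d) (E : measurableType d') (P : probability Om R)
    (X : {RV P >-> E}) (Q : set E -> \bar R) : Prop :=
  forall A : set E, measurable A -> distribution P X A = Q A.
Arguments has_law {R d d' Om E} P X Q.

(* Independence of a finite family, as the product rule over all its
   subfamilies. *)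
Definition mutually_independent (R : realType) (d d' : measure_display)
    (Om : measurableType d) (E : measurableType d') (P : probability Om R)
    (I : finType) (X : I -> Om -> E) : Prop :=
  forall (J : {set I}) (B : I -> set E), (forall i, measurable (B i)) ->
    P (\bigcap_(i in [set` J]) (X i @^-1` B i)) =
    (\prod_(i in J) P (X i @^-1` B i))%E.

Definition independent2 (R : realType) (d d1 d2 : measure_display)
    (Om : measurableType d) (E1 : measurableType d1) (E2 : measurableType d2)
    (P : probability Om R) (X : Om -> E1) (Y : Om -> E2) : Prop :=
  forall (A : set E1) (B : set E2), measurable A -> measurable B ->
    P (X @^-1` A `&` Y @^-1` B) = (P (X @^-1` A) * P (Y @^-1` B))%E.

(* Convergence in distribution, along a filter F on the index type T, of random
   vectors X t that may live on different probability spaces. *)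
Definition cvg_in_distribution (R : realType) (T : Type) (F : set_system T)
    (k : nat) (d : T -> measure_display) (Om : forall t, measurableType (d t))
    (P : forall t, probability (Om t) R) (X : forall t, Om t -> 'rV[R]_k.+1)
    (d' : measure_display) (Om' : measurableType d') (P' : probability Om' R)
    (Y : Om' -> 'rV[R]_k.+1) : Prop :=
  forall f : 'rV[R]_k.+1 -> R,
    continuous f -> (exists M : R, forall x, `|f x| <= M) ->
    ('E_(P t)[f \o X t])%E @[t --> F] --> ('E_P'[f \o Y])%E.

Definition Phi (R : realType) (x : R) : R :=
  fine (normal_prob (0 : R) 1 `]-oo, x]).

Definition normal_sample (R : realType) (d : measure_display)
    (Om : measurableType d) (P : probability Om R) (n : nat)
    (X : 'I_n.+1 -> {RV P >-> R}) (mu0 sigma0 mu sigma : R) : Prop :=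
  [/\ mutually_independent P (fun j => X j : Om -> R),
      has_law P (X ord0) (normal_prob mu0 sigma0) &
      forall j, j != ord0 -> has_law P (X j) (normal_prob mu sigma)].
Arguments normal_sample {R d Om} P {n} X mu0 sigma0 mu sigma.

Definition rank (R : realType) (Om : Type) (n : nat)
    (X : 'I_n.+1 -> Om -> R) (i : 'I_n.+1) (w : Om) : nat :=
  \sum_(j < n.+1) (X j w <= X i w)%R.

(* The row vector (x, y_0, ..., y_(m-1)). *)
Definition cons_rV (R : realType) (m : nat) (x : R) (y : 'I_m -> R) :
    'rV[R]_m.+1 :=
  \row_k (if unlift ord0 k is Some l then y l else x).

(* Vectors in {1, ..., n}^m: the entries are numbered from 1, as ranks are. *)
Definition distinct_tuples (n m : nat) : set (m.-tuple nat) :=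
  [set j : m.-tuple nat | all (fun x => 1 <= x <= n)%N j && uniq j].
Arguments distinct_tuples : clear implicits.

Definition uniform_on (R : realType) (d d' : measure_display)
    (Om : measurableType d) (E : measurableType d') (P : probability Om R)
    (A : set E) (U : {RV P >-> E}) : Prop :=
  forall u : E, P (U @^-1` [set u]) =
    (if u \in A then (#|` fset_set A|%fset)%:R^-1 else 0)%:E.
Arguments uniform_on {R d d' Om E} P A U.

Definition V_law (R : realType) (d : measure_display)
    (Om : measurableType d) (P : probability Om R)
    (n m : nat) (z : R) (V : {RV P >-> m.+1.-tuple nat}) : Prop :=
  forall v : m.+1.-tuple nat, let v0 := tnth v ord0 in
    P (V @^-1` [set v]) =
    (if v \in distinct_tuples n.+1 m.+1 then
       'C(n, v0.-1)%:R * z ^+ v0.-1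
         * (1 - z) ^+ (n.+1 - v0)
         / (\prod_(1 <= i < m.+1) (n - i + 1)%N%:R)
     else 0)%:E.
Arguments V_law {R d Om} P n {m} z V.

(* Main.v *)
Require Import Defs.
From HB Require Import structures.
From mathcomp Require Import all_boot all_order all_algebra all_fingroup.
From mathcomp Require Import finmap.
From mathcomp Require Import all_classical all_reals all_analysis.
From mathcomp Require Import measurable_realfun.
From mathcomp Require Import ring lra.
Import Order.TTheory GRing.Theory Num.Theory.
Import numFieldNormedType.Exports.

Set Implicit Arguments.
Unset Strict Implicit.
Unset Printing Implicit Defensive.

Local Open Scope classical_set_scope.
Local Open Scope ring_scope.

(** Every limit is obtained by coupling: on an event of probability close to 1
    the ranks coincide with, or are close to, variables whose law is known.

    For a fixed sample size the law of the rank vector has a rigid shape. The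
    variables of index other than [ord0] are exchangeable and ties have
    probability zero, so given the rank of [X ord0] the other ranks form a
    uniform sample without replacement from the remaining values
    ([rank_tuple_law]). The parameters act only through the law of the rank of
    [X ord0], and the limit laws have the same shape; hence only that
    one-dimensional law has to converge ([cvg_rank_tuple]). There are two
    regimes.
    - If the distribution function [F] of the other variables has the same
      limiting level [z] at all points within [K] standard deviations of the
      mean of [X ord0], then with high probability no other variable separates
      [X ord0] from a fixed threshold [a], and the rank of [X ord0] is one more
      than the number of variables below [a], which is binomial
      ([rank0_near_binomial], [cvg_rank0_binomial]). The limits in [delta] are
      the cases [z = 1] and [z = 0], the limits in [rho] at infinity the cases
      [z = 1 / 2] and [z = Phi (- r)].
    - If [rho] tends to 0, the other variables concentrate near [mu], which
      [X ord0] avoids with high probability, so that [X ord0] is the smallest or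
      the largest ([rank0_near_extreme], [cvg_rank0_extreme]).

    For large samples, the levels [F (X j)] already have exactly the limiting
    law: the level of [X ord0] is distributed as [Z], the others are uniform,
    and they are independent. By the Glivenko-Cantelli argument
    ([chebyshev_count], [glivenko_cantelli]) the empirical distribution function
    is uniformly close to [F], hence the rescaled ranks are close to the levels
    ([rank_near_F]), and a continuous function is uniformly continuous on the
    unit cube. The equality of the joint laws is used through finite sums only,
    after rounding all coordinates to a grid ([expectation_grid]). *)

(** * The standard normal distribution function *)

Section normal.
Variable R : realType.
Implicit Types m s x y : R.

Local Notation Phi := (@Phi R).
Local Notation N01 := (normal_prob (0 : R) 1).
Local Notation mu := (@lebesgue_measure R).

Lemma PhiE x : (Phi x)%:E = N01 `]-oo, x].
Proof. by rewrite fineK ?fin_num_measure. Qed.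

Lemma normal_pdf_scale m s x : 0 < s ->
  normal_pdf m s (s * x + m) * s = normal_pdf 0 1 x.
Proof.
move=> s0; rewrite !normal_pdfE ?oner_eq0 ?gt_eqF//.
rewrite /normal_peak /normal_fun /= addrK subr0 expr1n.
have -> : - (s * x) ^+ 2 / (s ^+ 2 *+ 2) = - x ^+ 2 / (1 *+ 2).
  rewrite !mulr2n; field; rewrite gt_eqF// addr_gt0 ?exprn_gt0//.
rewrite mulrAC; congr (_ * _).
rewrite -mulrnAr sqrtrM ?sqr_ge0// sqrtr_sqr gtr0_norm// invfM mulrAC mulVf
  ?gt_eqF//.
by rewrite !mul1r.
Qed.

(** The substitution [y |-> s * y + m] turns one density into the other. *)
Lemma normal_prob_halfline m s x : 0 < s ->
  normal_prob m s `]-oo, x] = (Phi ((x - m) / s))%:E.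
Proof.
move=> s0; rewrite PhiE /normal_prob.
pose F y := s * y + m.
have FD y : is_derive y (1 : R) F s.
  rewrite /F; apply: is_derive_eq.
  by rewrite addr0 /GRing.scale/= mulr1.
have dF y : derivable F y 1 by exact: ex_derive.
have F'E : F^`()%classic = cst s.
  by apply/funext => y; rewrite derive1E derive_val.
set b := (x - m) / s.
have Fb : F b = x by rewrite /F /b mulrC divfK ?gt_eqF// subrK.
rewrite -Fb (@increasing_ge0_integration_by_substitutionNy _ F (normal_pdf m s)
  b).
- apply: eq_integral => y _; rewrite F'E /= /F.
  by congr EFin; exact: normal_pdf_scale.
- by move=> y z _ _ yz; rewrite /F ltrD2r ltr_pM2l.
- by rewrite F'E => ? _; exact: cvg_cst.
- by rewrite F'E; exact: is_cvg_cst.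
- by rewrite F'E; exact: cvg_cst.
- split=> [y _|]; first exact: dF.
  apply: cvg_at_left_filter.
  by apply/differentiable_continuous/derivable1_diffP/dF.
- apply/cvgrNyPle => A; near=> y.
  rewrite /F -lerBrDr mulrC -ler_pdivlMr//; near: y.
- by apply: continuous_subspaceT; apply: continuous_normal_pdf; rewrite gt_eqF.
- by move=> y _; exact: normal_pdf_ge0.
Unshelve. all: end_near. Qed.

Lemma Phi_ge0 x : 0 <= Phi x.
Proof. by rewrite fine_ge0. Qed.

Lemma Phi_le1 x : Phi x <= 1.
Proof. by rewrite -lee_fin PhiE probability_le1. Qed.

Lemma normal_prob_itv m s a b : 0 < s -> a <= b ->
  normal_prob m s `]a, b] = (Phi ((b - m) / s) - Phi ((a - m) / s))%:E.
Proof.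
move=> s0 ab; rewrite EFinB -!normal_prob_halfline//.
have -> : `]-oo, b]%classic = `]-oo, a]%classic `|` `]a, b]%classic.
  by rewrite -itv_bndbnd_setU// ?bnd_simp.
rewrite measureU//; last first.
  by rewrite -subset0 => y []/=; rewrite !in_itv/= leNgt => /negbTE ->.
by rewrite addeAC subee ?add0e// fin_num_measure.
Qed.

Lemma normal_prob_set1 m s x : 0 < s -> normal_prob m s [set x] = 0%E.
Proof.
move=> s0; have /null_content_dominatesP H := normal_prob_dominates m s.
by apply: H => //; exact: lebesgue_measure_set1.
Qed.

Lemma Phi_itv a b : a <= b -> (Phi b - Phi a)%:E = N01 `]a, b].
Proof. by move=> ab; rewrite normal_prob_itv// !subr0 !divr1. Qed.

Lemma Phi_nondecreasing : {homo Phi : x y / x <= y}.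
Proof. by move=> x y xy; rewrite -subr_ge0 -lee_fin Phi_itv. Qed.

(** The density is bounded by its peak. *)
Lemma Phi_lipschitz a b : a <= b -> Phi b - Phi a <= normal_peak 1 * (b - a).
Proof.
move=> ab; rewrite -lee_fin Phi_itv// /normal_prob.
apply: (@le_trans _ _ (\int[mu]_(x in `]a, b]) (normal_peak 1)%:E))%E.
  apply: ge0_le_integral => //=.
  - by move=> y _; rewrite lee_fin normal_pdf_ge0.
  - apply/measurable_EFinP/measurable_funTS. exact: measurable_normal_pdf.
  - by move=> y _; rewrite lee_fin normal_pdf_ub ?oner_eq0.
rewrite integral_cst//= lebesgue_measure_itv/= lte_fin; case: ltP => [_|ba].
  by rewrite -EFinB -EFinM lee_fin.
by rewrite mule0 lee_fin mulr_ge0 ?normal_peak_ge0 ?subr_ge0.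
Qed.

Lemma Phi_continuous : continuous Phi.
Proof.
have p0 : 0 < normal_peak (1 : R) by rewrite normal_peak_gt0 ?oner_eq0.
move=> x; apply/cvgrPdist_le => e e0.
near=> y.
have : normal_peak 1 * `|x - y| <= e.
  rewrite -ler_pdivlMl// mulrC; near: y.
  by apply: cvgr_dist_le => //; rewrite divr_gt0.
apply: le_trans; have [xy|/ltW yx] := leP x y.
  by rewrite distrC (distrC x) !ger0_norm ?subr_ge0 ?Phi_nondecreasing//
    Phi_lipschitz.
by rewrite !ger0_norm ?subr_ge0 ?Phi_nondecreasing// Phi_lipschitz.
Unshelve. all: end_near. Qed.

Lemma PhiN x : Phi (- x) = 1 - Phi x.
Proof.
have E : N01 `]-oo, (- x)] = N01 `[x, +oo[.
  rewrite /normal_prob ge0_integration_by_substitutionNy.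
  - apply: eq_integral => y _; congr EFin.
    by rewrite /= !normal_pdfE ?oner_eq0// /normal_fun !subr0 sqrrN.
  - by apply: continuous_subspaceT; apply: continuous_normal_pdf; rewrite
    oner_eq0.
  - by move=> y _; exact: normal_pdf_ge0.
apply: EFin_inj; rewrite PhiE E EFinB PhiE.
have -> : `[x, +oo[%classic = [set x] `|` `]x, +oo[%classic :> set R.
  by rewrite setU1itv// bnd_simp.
rewrite measureU//; last first.
  by rewrite -subset0 => y []/= ->; rewrite in_itv/= ltxx.
rewrite [X in (X + _)%E = _](_ : _ = 0%E); last exact: normal_prob_set1.
rewrite add0e -setCitvl; exact: probability_setC.
Qed.

Lemma Phi0 : Phi 0 = 1 / 2.
Proof. by have := PhiN 0; rewrite oppr0 => H; lra. Qed.

Let idTR : measurableTypeR R -> R := idfun.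

#[local] HB.instance Definition _ :=
  @isMeasurableFun.Build _ _ _ _ idTR (@measurable_id _ _ setT).

Lemma Phi_cvg_pinfty : Phi @ +oo --> (1 : R).
Proof.
apply: fine_cvg.
have := cvg_cdfy1 (idTR : {RV N01 >-> R}).
apply: cvg_trans; apply: near_eq_cvg.
by near=> y; rewrite /cdf /distribution /pushforward preimage_id.
Unshelve. all: end_near. Qed.

Lemma Phi_cvg_ninfty : Phi @ -oo --> (0 : R).
Proof.
have -> : Phi = (fun x => 1 - Phi (- x)).
  by apply/funext => x; rewrite PhiN opprB addrC subrK.
rewrite -[X in _ --> X](subrr 1); apply: cvgB; first exact: cvg_cst.
by apply: cvg_comp Phi_cvg_pinfty; apply/cvgNry.
Qed.

Lemma Phi_surj u : 0 < u < 1 -> exists c, Phi c = u.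
Proof.
move=> /andP[u0 u1].
have [a au] : exists a, Phi a < u.
  near (-oo : set_system R)%R => a; exists a; near: a.
  exact: (cvgr_lt _ Phi_cvg_ninfty).
have [b bu] : exists b, u < Phi b.
  near (+oo : set_system R)%R => b; exists b; near: b.
  exact: (cvgr_gt _ Phi_cvg_pinfty).
have ab : a <= b.
  by rewrite leNgt; apply/negP => /ltW /Phi_nondecreasing; lra.
have [] := @IVT _ Phi a b u ab.
- exact/continuous_subspaceT/Phi_continuous.
- by rewrite ge_min le_max (ltW au) (ltW bu) orbT.
- by move=> c _ <-; exists c.
Unshelve. all: end_near. Qed.

(** On a bounded interval the density is bounded below by a positive constant.
  *)
Lemma Phi_increasing : {mono Phi : x y / x <= y}.
Proof.
apply: le_mono => a b ab.
pose c := Num.max `|a| `|b|; pose m := normal_pdf 0 1 c.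
have m0 : 0 < m.
  by rewrite /m normal_pdfE ?oner_eq0// mulr_gt0 ?normal_peak_gt0 ?oner_eq0
    ?expR_gt0.
have mle y : y \in `]a, b] -> m <= normal_pdf 0 1 y.
  rewrite in_itv/= => /andP[ay yb].
  have yc : `|y| <= c.
    rewrite ler_norml lerNl /c !le_max; apply/andP; split; apply/orP.
      left; rewrite -[leRHS]normrN (le_trans _ (ler_norm (- a)))// lerN2.
      exact: ltW.
    by right; rewrite (le_trans yb)// ler_norm.
  have c0 : 0 <= c by exact: le_trans yc.
  rewrite /m !normal_pdfE ?oner_eq0// ler_wpM2l ?normal_peak_ge0//.
  rewrite ler_expR !subr0 !mulNr lerN2 ler_wpM2r ?invr_ge0//.
  by rewrite -(real_normK (num_real y)) lerXn2r ?nnegrE.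
rewrite -subr_gt0 -lte_fin Phi_itv ?ltW// /normal_prob.
apply: (@lt_le_trans _ _ (\int[mu]_(x in `]a, b]) m%:E))%E.
  rewrite integral_cst//= lebesgue_measure_itv/= lte_fin ab -EFinB -EFinM.
  by rewrite lte_fin mulr_gt0// subr_gt0.
apply: ge0_le_integral => //=.
- by move=> y _; rewrite lee_fin ltW.
- by apply/measurable_EFinP/measurable_funTS; exact: measurable_normal_pdf.
Qed.

Lemma Phi_gt0 y : 0 < Phi y.
Proof.
apply: (le_lt_trans (Phi_ge0 (y - 1))).
by rewrite (leW_mono Phi_increasing) ltrBlDr ltrDl.
Qed.

(** Events about levels of [Phi] are thus events about half-lines; the first
    alternative is the level 0, which [Phi] never attains. *)
Lemma Phi_sublevel u : 0 <= u < 1 ->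
  (forall y, (Phi y <= u) = false) \/ exists z, forall y, (Phi y <= u) = (y <=
    z).
Proof.
move=> /andP[u0 u1]; have [->|un0] := eqVneq u 0; [left=> y|right].
  by apply/negbTE; rewrite -ltNge Phi_gt0.
have [|z <-] := @Phi_surj u; first by rewrite lt_def un0 u0.
by exists z => y; exact: Phi_increasing.
Qed.

End normal.

(** * Events *)

Definition pr (R : realType) (d : measure_display) (Om : measurableType d)
  (P : probability Om R) (A : set Om) : R := fine (P A).

Section pr.
Context {R : realType} {d : measure_display} {Om : measurableType d}.
Variable P : probability Om R.
Implicit Types A B : set Om.
Local Notation pr := (pr P).

Lemma prE A : measurable A -> (pr A)%:E = P A.
Proof. by move=> mA; rewrite fineK// fin_num_measure. Qed.

Lemma pr_ge0 A : 0 <= pr A.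
Proof. exact: fine_ge0. Qed.

Lemma le_pr A B : measurable A -> measurable B -> A `<=` B -> pr A <= pr B.
Proof.
by move=> mA mB AB; rewrite -lee_fin !prE// le_measure// inE.
Qed.

Lemma pr_setT : pr setT = 1.
Proof. by apply: EFin_inj; rewrite prE// probability_setT. Qed.

Lemma pr_set0 : pr set0 = 0.
Proof. by apply: EFin_inj; rewrite prE// measure0. Qed.

Lemma pr_setU A B : measurable A -> measurable B -> A `&` B `<=` set0 ->
  pr (A `|` B) = pr A + pr B.
Proof.
move=> mA mB AB; apply: EFin_inj.
rewrite EFinD !prE//; last exact: measurableU.
by rewrite measureU//; apply/seteqP; split.
Qed.

Lemma pr_setC A : measurable A -> pr (~` A) = 1 - pr A.
Proof.
by move=> mA; apply: EFin_inj; rewrite EFinB !prE//; [exact: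
  probability_setC|exact: measurableC].
Qed.

Lemma pr_setU_le A B : measurable A -> measurable B ->
  pr (A `|` B) <= pr A + pr B.
Proof.
move=> mA mB; rewrite -lee_fin EFinD !prE//; last exact: measurableU.
exact: measureU2.
Qed.

Lemma measurable_ex_seq (I : eqType) (s : seq I) (A : I -> set Om) :
  (forall i, i \in s -> measurable (A i)) ->
  measurable [set w | exists2 i, i \in s & A i w].
Proof.
elim: s => [|i s IH] mA.
  by rewrite [X in measurable X](_ : _ = set0)// -subset0 => w [].
rewrite [X in measurable X](_ : _ =
    A i `|` [set w | exists2 i, i \in s & A i w]).
  apply: measurableU; first by apply: mA; rewrite mem_head.
  by apply: IH => j js; apply: mA; rewrite in_cons js orbT.
apply/seteqP; split=> [w [j]|w [Aiw|[j js Ajw]]].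
- by rewrite in_cons => /predU1P[->|js Ajw]; [left|right; exists j].
- by exists i; rewrite ?mem_head.
- by exists j; rewrite // in_cons js orbT.
Qed.

Lemma pr_ex_seq_le (I : eqType) (s : seq I) (A : I -> set Om) :
  (forall i, i \in s -> measurable (A i)) ->
  pr [set w | exists2 i, i \in s & A i w] <= \sum_(i <- s) pr (A i).
Proof.
elim: s => [|i s IH] mA.
  rewrite big_nil [X in pr X](_ : _ = set0) ?pr_set0//.
  by rewrite -subset0 => w [].
rewrite [X in pr X](_ : _ = A i `|` [set w | exists2 i, i \in s & A i w]).
  have mA' j : j \in s -> measurable (A j).
    by move=> js; apply: mA; rewrite in_cons js orbT.
  rewrite big_cons (le_trans (pr_setU_le _ _))//.
  - by apply: mA; rewrite mem_head.
  - exact: measurable_ex_seq.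
  - by rewrite lerD2l; exact: IH.
apply/seteqP; split=> [w [j]|w [Aiw|[j js Ajw]]].
- by rewrite in_cons => /predU1P[->|js Ajw]; [left|right; exists j].
- by exists i; rewrite ?mem_head.
- by exists j; rewrite // in_cons js orbT.
Qed.

Lemma measurable_forall (I : finType) (A : I -> set Om) :
  (forall i, measurable (A i)) -> measurable [set w | forall i, A i w].
Proof.
move=> mA; rewrite [X in measurable X](_ : _ =
    ~` [set w | exists2 i, i \in enum I & (~` A i) w]).
  apply: measurableC; apply: (@measurable_ex_seq _ _ (fun i => ~` A i)) => i _.
  exact: measurableC.
apply/seteqP; split=> [w Aw [i _]|w nAw i]; first by apply.
by apply: contrapT => nAi; apply: nAw; exists i; rewrite ?mem_enum.
Qed.

Lemma measurable_exists (I : finType) (A : I -> set Om) :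
  (forall i, measurable (A i)) -> measurable [set w | exists i, A i w].
Proof.
move=> mA; rewrite [X in measurable X](_ : _ =
    [set w | exists2 i, i \in enum I & A i w]).
  exact: measurable_ex_seq.
apply/seteqP; split=> [w [i Ai]|w [i _ Ai]]; exists i => //.
by rewrite mem_enum.
Qed.

Lemma pr_exists_le (I : finType) (A : I -> set Om) :
  (forall i, measurable (A i)) ->
  pr [set w | exists i, A i w] <= \sum_i pr (A i).
Proof.
move=> mA; rewrite [X in pr X](_ : _ =
    [set w | exists2 i, i \in enum I & A i w]).
  by rewrite -big_enum; exact: pr_ex_seq_le.
apply/seteqP; split=> [w [i Ai]|w [i _ Ai]]; exists i => //.
by rewrite mem_enum.
Qed.

(** Ranks, counts and rounded values are all functions of finitely many
    comparisons, which makes this the source of their measurability. *)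
Lemma measurable_bool_family (I : finType) (b : I -> Om -> bool)
    (Q : {ffun I -> bool} -> Prop) :
  (forall i, measurable [set w | b i w]) ->
  measurable [set w | Q [ffun i => b i w]].
Proof.
move=> mb; rewrite [X in measurable X](_ : _ = [set w |
    exists c : {ffun I -> bool}, [set w | Q c /\ forall i, b i w = c i] w]).
  apply: measurable_exists => c; have [Qc|nQc] := pselect (Q c); last first.
    rewrite [X in measurable X](_ : _ = set0)//.
    by rewrite -subset0 => w [].
  rewrite [X in measurable X](_ : _ = [set w | forall i, b i w = c i]).
    apply: (@measurable_forall _ (fun i => [set w | b i w = c i])) => i.
    case: (c i); first exact: mb.
    rewrite [X in measurable X](_ : _ = ~` [set w | b i w]).
      exact/measurableC/mb.
    by apply/seteqP; split=> w /= => [->//|/negP/negbTE].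
  by apply/seteqP; split=> [w []//|w].
apply/seteqP; split=> [w Qw|w [c [Qc bc]]].
  by exists [ffun i => b i w]; split => // i; rewrite ffunE.
by rewrite /= (_ : [ffun i => _] = c)//; apply/ffunP => i; rewrite ffunE.
Qed.

Lemma measurable_set_le (f g : Om -> R) : measurable_fun setT f ->
  measurable_fun setT g -> measurable [set w | f w <= g w].
Proof.
move=> mf mg; have := measurable_fun_ler mf mg.
by move=> /(_ measurableT [set true] I); rewrite setTI.
Qed.

(** Law of total probability over the values of [g]. *)
Lemma pr_split (C : eqType) (s : seq C) (g : Om -> C) A :
  uniq s -> (forall c, c \in s -> measurable (A `&` [set w | g w = c])) ->
  (forall w, A w -> g w \in s) ->
  pr A = \sum_(c <- s) pr (A `&` [set w | g w = c]).
Proof.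
elim: s A => [|c s IH] A us mA As.
  rewrite big_nil [A](_ : _ = set0) ?pr_set0//.
  by rewrite -subset0 => w /As.
move: us; rewrite cons_uniq => /andP[cs us].
have Ac w : A w -> g w <> c -> g w \in s.
  by move=> /As; rewrite in_cons => /predU1P[].
pose A' := [set w | A w /\ g w <> c].
have A'E e : e \in s -> A' `&` [set w | g w = e] = A `&` [set w | g w = e].
  move=> es; apply/seteqP; split=> w [].
    by move=> [].
  move=> Aw /= ge; split => //; split => //.
  by move=> gc; move: cs; rewrite -gc ge es.
have mA' e : e \in s -> measurable (A' `&` [set w | g w = e]).
  by move=> es; rewrite A'E//; apply: mA; rewrite in_cons es orbT.
have mA'' : measurable A'.
  rewrite [A'](_ : _ = [set w | exists2 e, e \in s & (A' `&` [set w | g w = e])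
    w]).
    exact: measurable_ex_seq.
  apply/seteqP; split=> [w [Aw gw]|w [e es []]//].
  by exists (g w) => //; exact: Ac.
have IHA' : pr A' = \sum_(e <- s) pr (A `&` [set w | g w = e]).
  rewrite (IH A')//; first by apply: eq_big_seq => e es; rewrite A'E.
  by move=> w [Aw]; exact: Ac.
rewrite big_cons -IHA' -pr_setU//.
- congr pr; apply/seteqP; split=> [w Aw|w [[]//|[]//]].
  by have [gc|gc] := pselect (g w = c); [left|right].
- by apply: mA; rewrite mem_head.
- by move=> w [[_ /= gc] []].
Qed.

Lemma pr_near A1 A2 B : measurable A1 -> measurable A2 -> measurable B ->
  (forall w, ~ B w -> (A1 w <-> A2 w)) -> `|pr A1 - pr A2| <= pr B.
Proof.
move=> m1 m2 mB H.
have K A A' : measurable A -> measurable A' ->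
    (forall w, ~ B w -> A w -> A' w) -> pr A <= pr A' + pr B.
  move=> mA mA' AA'; apply: le_trans (pr_setU_le mA' mB).
  apply: le_pr => //; first exact: measurableU.
  by move=> w Aw; have [Bw|Bw] := pselect (B w); [right|left; exact: AA'].
rewrite ler_norml lerBlDr lerNl opprB lerBlDr ![pr B + _]addrC !K//.
- by move=> w /H[].
- by move=> w /H[].
Qed.

End pr.

(** * Expectations of bounded variables *)

Section expectation.
Context {R : realType} {d : measure_display} {Om : measurableType d}.
Variable P : probability Om R.
Implicit Types f : Om -> R.
Local Notation pr := (pr P).

Lemma bounded_integrable f (M : R) : measurable_fun setT f ->
  (forall w, `|f w| <= M) -> P.-integrable setT (EFin \o f).
Proof.
move=> mf fM; apply: measurable_bounded_integrable => //.
  by rewrite (le_lt_trans (probability_le1 _ _))// ltry.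
exists M; split; first exact: num_real.
by move=> x Mx y _; exact: le_trans (fM _) (ltW Mx).
Qed.

Lemma expectation_bounded f (M : R) : measurable_fun setT f ->
  (forall w, `|f w| <= M) -> 'E_P[f]%E = (\int[P]_w f w)%R%:E.
Proof.
move=> mf fM; rewrite unlock fineK//.
exact: integrable_fin_num (bounded_integrable mf fM).
Qed.

Lemma Rintegral_indic A : measurable A -> (\int[P]_w \1_A w = pr A)%R.
Proof. by move=> mA; rewrite /Rintegral integral_indic// setIT. Qed.

(** The integrand of the difference is at most [e] off [B] and at most [2 * M]
    on [B]. *)
Lemma expectation_near f1 f2 (M e : R) (B : set Om) :
  measurable_fun setT f1 -> measurable_fun setT f2 -> measurable B ->
  (forall w, `|f1 w| <= M) -> (forall w, `|f2 w| <= M) -> 0 <= e ->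
  (forall w, ~ B w -> `|f1 w - f2 w| <= e) ->
  `|\int[P]_w f1 w - \int[P]_w f2 w| <= e + 2 * M * pr B.
Proof.
move=> m1 m2 mB b1 b2 e0 close.
have i1 := bounded_integrable m1 b1; have i2 := bounded_integrable m2 b2.
have M0 (w : Om) : 0 <= M := le_trans (normr_ge0 _) (b1 w).
have i12 : P.-integrable setT (EFin \o (fun w => f1 w - f2 w)).
  apply: (@bounded_integrable _ (M + M)); first exact: measurable_funB.
  by move=> w; rewrite (le_trans (ler_normB _ _))// lerD.
rewrite -RintegralB// (le_trans (le_normr_Rintegral _ _))//.
have mi : measurable_fun setT (\1_B : Om -> R) by exact: measurable_indic.
have bi w : `|\1_B w : R| <= 1.
  by rewrite indicE; case: (_ \in _); rewrite ?normr1 ?normr0.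
have ib : P.-integrable setT (EFin \o (\1_B : Om -> R)).
  by apply: (@bounded_integrable _ 1).
have iM : P.-integrable setT (EFin \o (fun w => (2 * M) * \1_B w)).
  apply: (@bounded_integrable _ `|2 * M|); first exact: measurable_funM.
  by move=> w; rewrite normrM ler_piMr.
have ie : P.-integrable setT (EFin \o (fun=> e)).
  by apply: (@bounded_integrable _ `|e|) => //; exact: measurable_cst.
apply: (@le_trans _ _ (\int[P]_w (e + 2 * M * \1_B w))).
  apply: le_Rintegral => //.
  - exact: integrable_norm i12.
  - apply: (@bounded_integrable _ (e + `|2 * M|)).
      by apply: measurable_funD => //; exact: measurable_funM.
    move=> w; rewrite (le_trans (ler_normD _ _))// lerD//; first by rewrite
      ger0_norm.
    by rewrite normrM ler_piMr.
  - move=> w _; rewrite indicE; have [Bw|Bw] := pselect (B w).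
      rewrite mem_set// mulr1 (le_trans (ler_normB _ _))//.
      by rewrite (le_trans (lerD (b1 w) (b2 w)))// mulr_natl mulr2n lerDr.
    by rewrite memNset// mulr0 addr0 close.
rewrite RintegralD// Rintegral_cst// RintegralZl// Rintegral_indic//.
by rewrite [fine _](pr_setT P) mulr1.
Qed.

Lemma expectation_simple (C : eqType) (s : seq C) (h : C -> R) (A : C -> set Om)
  :
  (forall c, c \in s -> measurable (A c)) ->
  (\int[P]_w (\sum_(c <- s) h c * \1_(A c) w) = \sum_(c <- s) h c * pr (A c))%R.
Proof.
elim: s => [|c s IH] mA.
  under eq_Rintegral do rewrite big_nil.
  by rewrite big_nil Rintegral_cst// mul0r.
have mA' e : e \in s -> measurable (A e).
  by move=> es; apply: mA; rewrite in_cons es orbT.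
have mAc : measurable (A c) by apply: mA; rewrite mem_head.
under eq_Rintegral do rewrite big_cons.
have bi (B : set Om) w : `|\1_B w : R| <= 1.
  by rewrite indicE; case: (_ \in _); rewrite ?normr1 ?normr0.
have ib : P.-integrable setT (EFin \o (\1_(A c) : Om -> R)).
  by apply: (@bounded_integrable _ 1) => //; exact: measurable_indic.
rewrite RintegralD//.
- by rewrite RintegralZl// Rintegral_indic// IH// big_cons.
- apply: (@bounded_integrable _ `|h c|).
    by apply: measurable_funM => //; exact: measurable_indic.
  by move=> w; rewrite normrM ler_piMr.
- apply: (@bounded_integrable _ (\sum_(c <- s) `|h c|)).
    elim: s mA' {IH mA} => [|e s IH] mA'.
      by under eq_fun do rewrite big_nil; exact: measurable_cst.
    under eq_fun do rewrite big_cons.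
    apply: measurable_funD.
      by apply: measurable_funM => //; apply: measurable_indic; apply: mA';
        rewrite mem_head.
    by apply: IH => i iss; apply: mA'; rewrite in_cons iss orbT.
  move=> w; apply: (le_trans (ler_norm_sum _ _ _)); apply: ler_sum => e _.
  by rewrite normrM ler_piMr.
Qed.

(** The values of [g] outside [s] carry no mass. *)
Lemma expectation_finite (C : eqType) (s : seq C) (g : Om -> C) (h : C -> R)
    (M : R) : uniq s ->
  (forall c, c \in s -> measurable [set w | g w = c]) ->
  \sum_(c <- s) pr [set w | g w = c] = 1 ->
  measurable_fun setT (h \o g) -> (forall c, `|h c| <= M) ->
  (\int[P]_w h (g w) = \sum_(c <- s) h c * pr [set w | g w = c])%R.
Proof.
move=> us mg s1 mhg hM.
pose G := [set w | exists2 c, c \in s & [set w | g w = c] w].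
have mG : measurable G by exact: measurable_ex_seq.
have GT c : c \in s -> G `&` [set w | g w = c] = [set w | g w = c].
  by move=> cs; apply/seteqP; split=> [w []//|w gw]; split => //; exists c.
have G1 : pr G = 1.
  rewrite (@pr_split _ _ _ _ _ s g)//.
  - by rewrite -s1; apply: eq_big_seq => c cs; rewrite GT.
  - by move=> c cs; rewrite GT//; exact: mg.
  - by move=> w [c cs /= ->].
have GC : pr (~` G) = 0 by rewrite pr_setC// G1 subrr.
rewrite -expectation_simple//.
pose f2 w := \sum_(c <- s) h c * \1_[set w | g w = c] w.
have f2E w : G w -> f2 w = h (g w).
  move=> [c cs /= gw]; rewrite /f2 (bigD1_seq c)//= indicE mem_set//= mulr1 gw.
  rewrite big1_seq ?addr0// => e /andP[ec es].
  by rewrite indicE memNset ?mulr0//= gw => /esym/eqP; rewrite (negbTE ec).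
have f20 w : ~ G w -> f2 w = 0.
  move=> Gw; rewrite /f2 big1_seq// => e /andP[_ es].
  by rewrite indicE memNset ?mulr0// => gwe; apply: Gw; exists e.
have mf2 : measurable_fun setT f2.
  rewrite /f2; elim: s mg {us s1 G mG GT G1 GC f2 f2E f20} => [|e s IH] mA.
    by under eq_fun do rewrite big_nil; exact: measurable_cst.
  under eq_fun do rewrite big_cons.
  apply: measurable_funD.
    by apply: measurable_funM => //; apply: measurable_indic; apply: mA; rewrite
      mem_head.
  by apply: IH => i iss; apply: mA; rewrite in_cons iss orbT.
have M0 (w : Om) : 0 <= M := le_trans (normr_ge0 _) (hM (g w)).
have := @expectation_near (h \o g) f2 M 0 (~` G) mhg mf2 (measurableC mG).
rewrite GC mulr0 addr0 normr_le0 subr_eq0 => H; apply/eqP/H => //.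
- by move=> w; exact: hM.
- move=> w; have [Gw|Gw] := pselect (G w); first by rewrite f2E.
  by rewrite f20// normr0 (M0 w).
- by move=> w /contrapT Gw; rewrite /= f2E// subrr normr0.
Qed.

Lemma measurable_fibers (C : countType) (g : Om -> C) (A : set C) :
  (forall c, measurable [set w | g w = c]) -> measurable (g @^-1` A).
Proof.
move=> mg.
rewrite [_ @^-1` _](_ : _ =
    \bigcup_n (if choice.unpickle n is Some c then
                 if `[< A c >] then [set w | g w = c] else set0 else set0)).
  apply: bigcupT_measurable => n; case: choice.unpickle => // c.
  by case: ifP => _ //; exact: mg.
apply/seteqP; split=> [w Agw|w [n _]].
  by exists (choice.pickle (g w)) => //; rewrite choice.pickleK; case: asboolP.
by case: choice.unpickle => // c; case: asboolP => // Ac /= gw; rewrite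
  /preimage/= gw.
Qed.

Lemma measurable_fun_fibers (C : countType) (g : Om -> C) (h : C -> R) :
  (forall c, measurable [set w | g w = c]) -> measurable_fun setT (h \o g).
Proof.
by move=> mg _ B _; rewrite setTI comp_preimage; exact: measurable_fibers.
Qed.

End expectation.

Lemma cvg_sum_seq (R : realType) (T : Type) (F : set_system T)
    (FF : ProperFilter F) (C : eqType) (s : seq C) (f : T -> C -> R)
    (l : C -> R) : (forall c, c \in s -> f t c @[t --> F] --> l c) ->
  (\sum_(c <- s) f t c) @[t --> F] --> \sum_(c <- s) l c.
Proof.
elim: s => [|c s IH] fl.
  rewrite big_nil (_ : (fun t => _) = cst 0); first exact: cvg_cst.
  by apply/funext => t; rewrite big_nil.
rewrite big_cons (_ : (fun t => _) =
    (fun t => f t c + \sum_(c <- s) f t c)); last first.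
  by apply/funext => t; rewrite big_cons.
apply: cvgD; first by apply: fl; rewrite mem_head.
by apply: IH => e es; apply: fl; rewrite in_cons es orbT.
Qed.

(** For variables confined to a fixed finite set, convergence of the point
    probabilities is enough; the limit cannot lose mass. *)
Lemma cvg_expectation_finite (R : realType) (T : Type) (F : set_system T)
    (FF : ProperFilter F) (C : countType) (s : seq C)
    (d : T -> measure_display) (Om : forall t, measurableType (d t))
    (P : forall t, probability (Om t) R) (g : forall t, Om t -> C)
    (d' : measure_display) (Om' : measurableType d') (P' : probability Om' R)
    (Y : Om' -> C) (h : C -> R) (M : R) :
  uniq s ->
  (forall t c, measurable [set w | g t w = c]) ->
  (forall t w, g t w \in s) ->
  (forall c, measurable [set w | Y w = c]) ->
  (forall c, c \in s ->
    pr (P t) [set w | g t w = c] @[t --> F] --> pr P' [set w | Y w = c]) ->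
  (forall c, `|h c| <= M) ->
  ('E_(P t)[fun w => h (g t w)])%E @[t --> F] --> ('E_P'[fun w => h (Y w)])%E.
Proof.
move=> us mg gs mY cY hM.
have S1 t : \sum_(c <- s) pr (P t) [set w | g t w = c] = 1.
  rewrite -(pr_setT (P t)) (@pr_split _ _ _ _ _ s (g t))//.
    by apply: eq_bigr => c _; rewrite setTI.
  by move=> c _; rewrite setTI.
have Y1 : \sum_(c <- s) pr P' [set w | Y w = c] = 1.
  apply: (@cvg_unique _ _ (\sum_(c <- s) pr (P t) [set w | g t w = c] @[t -->
    F])).
  - exact: Rhausdorff.
  - exact: cvg_sum_seq.
  - by rewrite (funext S1); exact: cvg_cst.
have Eg t : 'E_(P t)[fun w => h (g t w)]%E =
    (\sum_(c <- s) h c * pr (P t) [set w | g t w = c])%:E.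
  rewrite (@expectation_bounded _ _ _ _ _ M)//; last exact:
    measurable_fun_fibers.
  by rewrite (@expectation_finite _ _ _ _ _ s (g t) h M)//; exact:
    measurable_fun_fibers.
rewrite (funext Eg) (@expectation_bounded _ _ _ _ _ M)//; last exact:
  measurable_fun_fibers.
rewrite (@expectation_finite _ _ _ _ _ s Y h M)//; last exact:
  measurable_fun_fibers.
apply: cvg_EFin; first by near=> t.
apply: cvg_sum_seq => c cs.
by apply: cvgM; [exact: cvg_cst|exact: cY].
Unshelve. all: end_near. Qed.

(** * Laws of random tuples *)

(** Boxes form a pi-system that generates the sigma-algebra of the space of
    tuples, so they determine the law of a random tuple. *)
Lemma tuple_law_unique (R : realType) (d : measure_display)
    (Om : measurableType d) (P : probability Om R) (k : nat)
    (W1 W2 : {RV P >-> k.-tuple R}) :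
  (forall B : 'I_k -> set R, (forall i, measurable (B i)) ->
     P [set w | forall i, B i (tnth (W1 w) i)] =
     P [set w | forall i, B i (tnth (W2 w) i)]) ->
  forall E : set (k.-tuple R), measurable E -> P (W1 @^-1` E) = P (W2 @^-1` E).
Proof.
move=> W12 E mE.
pose G : set (set (k.-tuple R)) := [set E | exists2 B : 'I_k -> set R,
  (forall i, measurable (B i)) & E = [set x | forall i, B i (tnth x i)]].
have mB (B : 'I_k -> set R) : (forall i, measurable (B i)) ->
    measurable [set x : k.-tuple R | forall i, B i (tnth x i)].
  move=> mB; apply: (measurable_forall
    (A := fun i => (fun x : k.-tuple R => tnth x i) @^-1` B i)) => i.
  by rewrite -[_ @^-1` _]setTI; exact: measurable_tnth.
apply: (@measure_unique _ _ _ G (fun=> setT) _ _ _ _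
  (distribution P W1) (distribution P W2)) => //.
- apply/seteqP; split.
    apply: smallest_sub; first exact: smallest_sigma_algebra.
    move=> A; rewrite -bigcup_seq => -[i _ [B mBi <-]].
    apply: sub_sigma_algebra; exists (fun j => if j == i then B else setT).
      by move=> j; case: ifP.
    rewrite setTI; apply/seteqP; split=> [x Bx j|x /(_ i)]; last by rewrite
      eqxx.
    by case: eqP => // ->.
  apply: smallest_sub; first exact: sigma_algebra_measurable.
  by move=> _ [B mBi ->]; exact: mB.
- move=> _ _ [B1 m1 ->] [B2 m2 ->]; exists (fun i => B1 i `&` B2 i).
    by move=> i; exact: measurableI.
  apply/seteqP; split=> [x [b1 b2] i|x b]; first by split.
  by split=> i; case: (b i).
- by move=> _; exists (fun=> setT) => //; apply/seteqP; split.
- by rewrite bigcup_const.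
- by move=> _ [B m ->]; exact: W12.
- by move=> _; rewrite /distribution /pushforward (le_lt_trans (probability_le1
  _ _))// ltry.
Qed.

(** * Ranks *)

Section rank.
Context {R : realType} {Om : Type} {n : nat}.
Variables (X : 'I_n.+1 -> Om -> R) (w : Om).

Lemma rankE i : rank X i w = #|[pred j | X j w <= X i w]|.
Proof.
rewrite -sum1_card big_mkcond /rank.
apply: (@eq_bigr nat 0%N addn) => j _; rewrite inE.
by case: (X j w <= X i w).
Qed.

Lemma rank_gt0 i : (0 < rank X i w)%N.
Proof. by rewrite rankE; apply/card_gt0P; exists i; rewrite inE. Qed.

Lemma rank_le i : (rank X i w <= n.+1)%N.
Proof. by rewrite rankE -[X in (_ <= X)%N]card_ord max_card. Qed.

Hypothesis no_ties : injective (fun i => X i w).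

Lemma rank_inj : injective (fun i => rank X i w).
Proof.
have lt i k : X i w < X k w -> (rank X i w < rank X k w)%N.
  move=> ik; rewrite !rankE; apply: proper_card; apply/properP; split.
    by apply/fintype.subsetP => j; rewrite !inE => /le_trans; apply; exact: ltW.
  by exists k; rewrite inE// -ltNge.
move=> i k ik; apply: no_ties; case: (ltgtP (X i w) (X k w)) => // /lt.
  by rewrite ik ltnn.
by rewrite ik ltnn.
Qed.

(** [n.+1] distinct ranks exhaust the [n.+1] possible values. *)
Lemma rank_surj v : (1 <= v <= n.+1)%N -> exists i, rank X i w = v.
Proof.
move=> /andP[v0 vn].
have r_lt i : ((rank X i w).-1 < n.+1)%N by rewrite prednK ?rank_gt0 ?rank_le.
pose r i := Ordinal (r_lt i).
have r_inj : injective r.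
  move=> i k [/(congr1 S)]; rewrite !prednK ?rank_gt0//; exact: rank_inj.
have v_lt : (v.-1 < n.+1)%N by rewrite prednK.
have /codomP[i /(congr1 val)/= vi] := injF_onto r_inj (Ordinal v_lt).
by exists i; rewrite -(prednK (rank_gt0 i)) -vi prednK.
Qed.

End rank.

Lemma rank_perm (R : realType) (Om : Type) (n : nat) (X : 'I_n.+1 -> Om -> R)
    (s : 'S_n.+1) (i : 'I_n.+1) (w : Om) :
  rank (fun j => X (s j)) i w = rank X (s i) w.
Proof.
rewrite /rank [RHS](reindex_inj (@perm_inj _ s)); exact: eq_bigr.
Qed.

(** The images are corrected one index at a time by transpositions. *)
Lemma perm_extending (n m : nat) (f g : 'I_m -> 'I_n) :
  injective f -> injective g -> exists s : 'S_n, forall k, s (f k) = g k.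
Proof.
move=> fi gi.
have H p : (p <= m)%N -> exists s : 'S_n, forall k : 'I_m, (k < p)%N -> s (f k)
  = g k.
  elim: p => [|p IH] pm; first by exists 1%g.
  have [s sp] := IH (ltnW pm).
  pose q := Ordinal pm; exists (s * tperm (s (f q)) (g q))%g => k kp.
  rewrite permM; have [->|kq] := eqVneq k q; first by rewrite tpermL.
  have {}kp : (k < p)%N.
    by rewrite ltn_neqAle -ltnS kp andbT; apply: contraNneq kq => kp';
      apply/eqP/val_inj.
  rewrite tpermD.
  - exact: sp.
  - by apply: contraNneq kq => /perm_inj/fi ->.
  - by rewrite sp//; apply: contraNneq kq => /gi ->.
have [s sf] := H m (leqnn m); exists s => k; exact: sf.
Qed.

Lemma measurable_ranks (R : realType) (d : measure_display)
    (Om : measurableType d) (n : nat) (Y : 'I_n.+1 -> Om -> R)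
    (Q : {ffun 'I_n.+1 -> nat} -> Prop) :
  (forall j, measurable_fun setT (Y j)) ->
  measurable [set w | Q [ffun i => rank Y i w]].
Proof.
move=> mY.
have := @measurable_bool_family _ Om _ (fun p w => Y p.2 w <= Y p.1 w)
  (fun c => Q [ffun i : 'I_n.+1 => (\sum_(j < n.+1) c (i, j) : nat)]).
move=> /(_ (fun p => measurable_set_le (mY _) (mY _))).
rewrite (_ : mkset _ = [set w | Q [ffun i => rank Y i w]])//.
apply/funext => w; rewrite /mkset; congr Q; apply/ffunP => i.
by rewrite !ffunE; apply: eq_bigr => j _; rewrite ffunE.
Qed.

Definition rank_tuple (R : realType) (Om : Type) (n m : nat)
    (X : 'I_n.+1 -> Om -> R) (i : 'I_m -> 'I_n.+1) (w : Om) : m.+1.-tuple nat :=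
  [tuple of rank X ord0 w :: [tuple rank X (i k) w | k < m]].

Lemma rank_tupleP (R : realType) (Om : Type) (n m : nat)
    (X : 'I_n.+1 -> Om -> R) (i : 'I_m -> 'I_n.+1) (w : Om)
    (v : m.+1.-tuple nat) :
  rank_tuple X i w = v <-> rank X ord0 w = tnth v ord0 /\
    forall k, rank X (i k) w = tnth v (lift ord0 k).
Proof.
split=> [<-|[v0 vk]].
  by split=> [|k]; rewrite /rank_tuple ?tnth0// tnthS tnth_mktuple.
apply: eq_from_tnth => k; case: (unliftP ord0 k) => [l ->|->].
  by rewrite /rank_tuple tnthS tnth_mktuple.
by rewrite /rank_tuple tnth0.
Qed.

Lemma mem_distinct_tuples (n m : nat) (v : m.-tuple nat) :
  v \in distinct_tuples n m <->
    (forall k, 1 <= tnth v k <= n)%N /\ injective (tnth v).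
Proof.
rewrite inE /distinct_tuples /=; split=> [/andP[/all_tnthP b
  /tuple_uniqP]//|[b]].
by move=> /tuple_uniqP ->; rewrite andbT; apply/all_tnthP.
Qed.

(** * Exchangeability of the ranks *)

Section exchangeable.
Context {R : realType} {d : measure_display} {Om : measurableType d}.
Variables (P : probability Om R) (n : nat) (X : 'I_n.+1 -> {RV P >-> R}).
Local Notation x := (fun j => X j : Om -> R).

Hypothesis indep : mutually_independent P (fun j => X j : Om -> R).

Lemma indep_box (B : 'I_n.+1 -> set R) : (forall i, measurable (B i)) ->
  P [set w | forall i, B i (X i w)] = (\prod_i P (X i @^-1` B i))%E.
Proof.
move=> mB; have := @indep [set: _]%SET B mB.
rewrite (_ : \bigcap_(i in _) _ = [set w | forall i, B i (X i w)]).
  by move=> ->; apply: eq_bigl => i; rewrite inE.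
apply/seteqP; split=> [w Bw i|w Bw i _]; last exact: Bw.
by apply: Bw; rewrite /= inE.
Qed.

Lemma indep_pair i k A B : i != k -> measurable A -> measurable B ->
  P (X i @^-1` A `&` X k @^-1` B) = (P (X i @^-1` A) * P (X k @^-1` B))%E.
Proof.
move=> ik mA mB.
have mC j : measurable (if j == i then A else B) by case: ifP.
have := @indep [set i; k]%SET (fun j => if j == i then A else B) mC.
rewrite big_setU1 ?inE//= big_set1 eqxx eq_sym (negbTE ik) => <-.
congr (P _); apply/seteqP; split=> [w [Aw Bw] j /=|w AB].
  by rewrite !inE => /orP[/eqP ->|/eqP ->]; rewrite ?eqxx// eq_sym (negbTE ik).
split.
  by have := AB i; rewrite /= !inE !eqxx => /(_ isT).
by have := AB k; rewrite /= !inE !eqxx orbT eq_sym (negbTE ik) => /(_ isT).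
Qed.

(** By Fubini, an independent pair charges the diagonal only through atoms. *)
Lemma indep_pair_neq i k : i != k ->
  (forall y, P (X k @^-1` [set y]) = 0%E) -> P [set w | X i w = X k w] = 0%E.
Proof.
move=> ik atomless.
have mXX : measurable_fun setT (fun w => (X i w, X k w)).
  by apply: measurable_fun_pair.
pose XX : {mfun Om >-> (R * R)%type} := mfun_Sub (mem_set mXX).
have mD : measurable [set p : R * R | p.1 = p.2].
  have := @measurable_fun_eqr _ (R * R)%type R setT fst snd.
  move=> /(_ measurable_fst measurable_snd measurableT [set true] I).
  by rewrite setTI (_ : _ @^-1` _ = [set p : R * R | p.1 = p.2])//;
    apply/seteqP; split=> p /= /eqP.
pose D : set (R * R) := [set p | p.1 = p.2].
have <- : (distribution P (X i) \x distribution P (X k))%E D =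
    P [set w | X i w = X k w].
  rewrite (@product_measure_unique _ _ _ _ _ (distribution P (X i))
    (distribution P (X k)) (distribution P XX))//.
  by move=> A B mA mB; exact: indep_pair.
rewrite /product_measure1 integral0_eq// => y _.
rewrite /= (_ : xsection D y = [set y]); first exact: atomless.
by apply/seteqP; split=> z; rewrite /xsection/= inE.
Qed.

Hypothesis same_law : forall i k, i != ord0 -> k != ord0 ->
  forall B, measurable B -> P (X i @^-1` B) = P (X k @^-1` B).

(** A permutation that fixes [ord0] preserves the product of the marginal laws,
    hence the law of the whole sample, of which the ranks are functions. *)
Lemma rank_exchangeable (s : 'S_n.+1) (Q : {ffun 'I_n.+1 -> nat} -> Prop) :
  s ord0 = ord0 ->
  P [set w | Q [ffun i => rank x i w]] = P [set w | Q [ffun i => rank x (s i)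
    w]].
Proof.
move=> s0.
have mW1 : measurable_fun setT (fun w => [tuple X i w | i < n.+1]).
  apply/measurable_fun_tnthP => i; rewrite (_ : _ \o _ = X i)//.
  by apply/funext => w; rewrite /= tnth_mktuple.
have mW2 : measurable_fun setT (fun w => [tuple X (s i) w | i < n.+1]).
  apply/measurable_fun_tnthP => i; rewrite (_ : _ \o _ = X (s i))//.
  by apply/funext => w; rewrite /= tnth_mktuple.
pose y (j : 'I_n.+1) (z : n.+1.-tuple R) := tnth z j.
have := @tuple_law_unique _ _ _ P _ (mfun_Sub (mem_set mW1))
  (mfun_Sub (mem_set mW2)) _ [set z | Q [ffun i => rank y i z]].
have -> : (mfun_Sub (mem_set mW1) @^-1` [set z | Q [ffun i => rank y i z]]) =
    [set w | Q [ffun i => rank x i w]].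
  apply/funext => w; rewrite /preimage /mkset; congr Q; apply/ffunP => i.
  by rewrite !ffunE; apply: eq_bigr => j _; rewrite /y !tnth_mktuple.
have -> : (mfun_Sub (mem_set mW2) @^-1` [set z | Q [ffun i => rank y i z]]) =
    [set w | Q [ffun i => rank x (s i) w]].
  apply/funext => w; rewrite /preimage /mkset; congr Q; apply/ffunP => i.
  rewrite !ffunE -(rank_perm x).
  by apply: eq_bigr => j _; rewrite /y !tnth_mktuple.
apply; last by apply: measurable_ranks => j; exact: measurable_tnth.
move=> B mB.
transitivity (\prod_i P (X i @^-1` B i))%E.
  rewrite -indep_box//; congr (P _); apply/seteqP; split=> w /= Bw i.
    by have := Bw i; rewrite tnth_mktuple.
  by rewrite tnth_mktuple.
transitivity (\prod_i P (X i @^-1` (B (s^-1 i)%g)))%E.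
  rewrite [RHS](reindex_inj (@perm_inj _ s)); apply: eq_bigr => i _.
  rewrite permK; have [->|i0] := eqVneq i ord0; first by rewrite s0.
  apply: same_law => //; apply: contraNneq i0 => /esym si0.
  by apply/eqP/(@perm_inj _ s); rewrite s0.
rewrite -indep_box; last by move=> i; exact: mB.
congr (P _); apply/seteqP; split=> w /= Bw i.
  by have := Bw (s i); rewrite tnth_mktuple permK.
by have := Bw (s^-1 i)%g; rewrite tnth_mktuple permKV.
Qed.

Hypothesis atomless : forall i y, P (X i @^-1` [set y]) = 0%E.

Lemma measurable_ties (i k : 'I_n.+1) :
  measurable [set w | i != k /\ X i w = X k w].
Proof.
have [_|_] := eqVneq i k.
  by rewrite [X in measurable X](_ : _ = set0)// -subset0 => w [].
rewrite [X in measurable X](_ : _ =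
    [set w | X i w <= X k w] `&` [set w | X k w <= X i w]).
  by apply: measurableI; exact: measurable_set_le.
by apply/seteqP; split=> w /= [] => [_ ->//|le ge]; split => //;
  apply/le_anti/andP.
Qed.

Let tiesE : [set w | ~ injective (fun i => X i w)] =
  [set w | exists p : 'I_n.+1 * 'I_n.+1,
     [set w | p.1 != p.2 /\ X p.1 w = X p.2 w] w].
Proof.
apply/seteqP; split=> [w nI|w [[i k] /= [ik Xik]] I]; last first.
  by rewrite (I _ _ Xik) eqxx in ik.
apply: contrapT => nE; apply: nI => i k Xik; apply: contrapT => /eqP ik.
by apply: nE; exists (i, k).
Qed.

Lemma measurable_no_ties : measurable [set w | injective (fun i => X i w)].
Proof.
rewrite [X in measurable X](_ : _ = ~` [set w | ~ injective (fun i => X i w)]).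
  apply: measurableC; rewrite tiesE.
  by apply: measurable_exists => p; exact: measurable_ties.
by apply/seteqP; split=> w /= => [I /(_ I)//|/contrapT].
Qed.

Lemma pr_ties : pr P (~` [set w | injective (fun i => X i w)]) = 0.
Proof.
have pt p : pr P [set w | p.1 != p.2 /\ X p.1 w = X p.2 w] = 0.
  have [p12|p12] := eqVneq p.1 p.2.
    rewrite [X in pr P X](_ : _ = set0) ?pr_set0//.
    by rewrite -subset0 => w [].
  rewrite [X in pr P X](_ : _ = [set w | X p.1 w = X p.2 w]).
    by rewrite /pr indep_pair_neq.
  by apply/seteqP; split=> w //= [].
apply: le_anti; rewrite pr_ge0 andbT.
rewrite [X in pr P X](_ : _ = [set w | ~ injective (fun i => X i w)])// tiesE.
rewrite (le_trans (pr_exists_le _ _))//; first by move=> p; exact: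
  measurable_ties.
by rewrite big1.
Qed.

Lemma measurable_rank_tuple m (i : 'I_m -> 'I_n.+1) v :
  measurable [set w | rank_tuple x i w = v].
Proof.
have := @measurable_ranks _ _ Om n x (fun r => r ord0 = tnth v ord0 /\
  forall k, r (i k) = tnth v (lift ord0 k)).
rewrite (_ : mkset _ = [set w | rank_tuple x i w = v]); first by apply.
apply/seteqP; split=> w.
  move=> [r0 rk]; apply/rank_tupleP; split=> [|k]; first by rewrite -r0 ffunE.
  by rewrite -rk ffunE.
move=> /= /rank_tupleP[r0 rk]; split=> [|k]; first by rewrite ffunE.
by rewrite ffunE.
Qed.

Let avoid0 m : {set {ffun 'I_m -> 'I_n.+1}} :=
  [set f : {ffun 'I_m -> 'I_n.+1} in ffun_on (predC1 ord0) | injectiveb f].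

(** The two index families, completed by [ord0], are exchanged by a
    permutation. *)
Lemma rank_tuple_exchangeable m (i j : 'I_m -> 'I_n.+1) v :
  injective i -> injective j ->
  (forall k, i k != ord0) -> (forall k, j k != ord0) ->
  pr P [set w | rank_tuple x i w = v] = pr P [set w | rank_tuple x j w = v].
Proof.
move=> ii ji i0 j0.
pose ext (f : 'I_m -> 'I_n.+1) (k : 'I_m.+1) :=
  if unlift ord0 k is Some l then f l else ord0.
have ext_inj f : injective f -> (forall k, f k != ord0) -> injective (ext f).
  move=> fi f0 k l; rewrite /ext.
  case: unliftP => [k' ->|->]; case: unliftP => [l' ->|->] //.
  - by move=> /fi ->.
  - by move=> fk; have := f0 k'; rewrite fk eqxx.
  - by move=> fl; have := f0 l'; rewrite -fl eqxx.
have [s sE] := perm_extending (ext_inj i ii i0) (ext_inj j ji j0).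
have s0 : s ord0 = ord0 by have := sE ord0; rewrite /ext unlift_none.
have si k : s (i k) = j k by have := sE (lift ord0 k); rewrite /ext liftK.
pose Q (r : {ffun 'I_n.+1 -> nat}) := r ord0 = tnth v ord0 /\
  forall k, r (i k) = tnth v (lift ord0 k).
have QE (t : 'I_n.+1 -> 'I_n.+1) f : t ord0 = ord0 ->
    (forall k, t (i k) = f k) ->
    [set w | rank_tuple x f w = v] = [set w | Q [ffun k => rank x (t k) w]].
  move=> t0 tf; apply/seteqP; split=> w.
    move=> /= /rank_tupleP[r0 rk]; split=> [|k]; first by rewrite ffunE t0.
    by rewrite ffunE tf.
  move=> [r0 rk]; apply/rank_tupleP; split=> [|k].
    by rewrite -r0 ffunE t0.
  by rewrite -rk ffunE tf.
by rewrite /pr (QE id i)// (QE s j)// (rank_exchangeable Q s0).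
Qed.

Let N := [set w | injective (fun i => X i w)].

Let pr_eqN A B : measurable A -> measurable B ->
  (forall w, N w -> A w <-> B w) -> pr P A = pr P B.
Proof.
move=> mA mB AB; have := pr_near P mA mB (measurableC measurable_no_ties).
rewrite pr_ties normr_le0 subr_eq0 => H; apply/eqP/H => w /contrapT.
exact: AB.
Qed.

(** Given the rank of [X ord0], the other ranks are a uniform sample without
    replacement from the remaining ones: every choice of [m] indices is equally
    likely to carry them, and almost surely exactly one choice does. *)
Lemma rank_tuple_law m (i : 'I_m -> 'I_n.+1) v :
  injective i -> (forall k, i k != ord0) ->
  pr P [set w | rank_tuple x i w = v] =
  if v \in distinct_tuples n.+1 m.+1
  then pr P [set w | rank x ord0 w = tnth v ord0] / (n ^_ m)%:R else 0.
Proof.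
move=> ii i0; case: ifPn => vd; last first.
  rewrite -(pr_set0 P); apply: pr_eqN => //; first exact: measurable_rank_tuple.
  move=> w Nw; split=> // /rank_tupleP[r0 rk]; apply: (negP vd).
  apply/mem_distinct_tuples; split=> [k|k l].
    case: (unliftP ord0 k) => [l ->|->]; rewrite -?rk -?r0 rank_gt0 rank_le//.
  case: (unliftP ord0 k) => [k' ->|->]; case: (unliftP ord0 l) => [l' ->|->] //;
    rewrite -?rk -?r0 => /(@rank_inj _ _ _ x w Nw).
  - by move=> /ii ->.
  - by move=> /eqP; rewrite (negbTE (i0 _)).
  - by move=> /esym/eqP; rewrite (negbTE (i0 _)).
have /mem_distinct_tuples[vb vi] := vd.
pose A := [set w | rank x ord0 w = tnth v ord0].
have mA : measurable A.
  have := @measurable_ranks _ _ Om n x (fun r => r ord0 = tnth v ord0).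
  rewrite (_ : mkset _ = A); first by apply.
  by apply/funext => w; rewrite /mkset /A /= ffunE.
have mN : measurable N := measurable_no_ties.
(* The choice of indices that carry the ranks [v]; [ord0] is a default value,
   never used when there are no ties. *)
pose g w := [ffun k : 'I_m =>
  odflt ord0 [pick j | rank x j w == tnth v (lift ord0 k)]].
have gE f w : N w -> (A w /\ g w = f) <-> rank_tuple x f w = v.
  move=> Nw; split=> [[Aw <-]|/rank_tupleP[r0 rk]].
    apply/rank_tupleP; split=> // k; rewrite ffunE.
    case: pickP => [j /eqP//|none].
    have [j rj] := @rank_surj _ _ _ x w Nw _ (vb (lift ord0 k)).
    by have := none j; rewrite rj eqxx.
  split=> //; apply/ffunP => k; rewrite ffunE.
  case: pickP => [j /eqP|none]; first by rewrite -rk => /(@rank_inj _ _ _ x w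
    Nw).
  by have := none (f k); rewrite rk eqxx.
have ANg f : A `&` N `&` [set w | g w = f] = N `&` [set w | rank_tuple x f w =
  v].
  apply/seteqP; split=> [w [[Aw Nw] gw]|w [Nw /= /gE-/(_ Nw)[Aw gw]]] //.
  by split => //; apply/gE.
have mANg f : measurable (A `&` N `&` [set w | g w = f]).
  by rewrite ANg; apply: measurableI => //; exact: measurable_rank_tuple.
have gJ w : (A `&` N) w -> g w \in avoid0 m.
  move=> [Aw Nw]; have /(gE (g w) w Nw)/rank_tupleP[r0 rk] : A w /\ g w = g w by
    [].
  rewrite inE; apply/andP; split.
    apply/ffun_onP => k; rewrite inE; apply/eqP => gk.
    by have := rk k; rewrite gk r0 => /vi.
  by apply/injectiveP => k l gkl; have := rk k; rewrite gkl rk => /vi/lift_inj.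
have -> : pr P A = \sum_(f in avoid0 m) pr P [set w | rank_tuple x i w = v].
  transitivity (pr P (A `&` N)).
    apply: pr_eqN => //; first exact: measurableI.
    by move=> w Nw; split=> [|[]].
  rewrite (@pr_split _ _ _ _ _ (enum (avoid0 m)) g) ?enum_uniq//; last first.
    by move=> w /gJ; rewrite mem_enum.
  rewrite big_enum/=; apply: eq_bigr => f; rewrite inE => /andP[/ffun_onP f0
    /injectiveP fi].
  have f0' k : f k != ord0 by have := f0 k; rewrite inE.
  rewrite ANg (@rank_tuple_exchangeable m i f)//.
  apply: pr_eqN => //; [|exact: measurable_rank_tuple|].
    by apply: measurableI => //; exact: measurable_rank_tuple.
  by move=> w Nw; split=> [[]//|].
rewrite sumr_const (_ : #|avoid0 m| = n ^_ m).
  rewrite -[X in _ = X / _]mulr_natr mulfK// pnatr_eq0 -lt0n ffact_gt0.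
  rewrite -[m in (m <= _)%N]card_ord -(card_codom ii).
  have := cardC1 (ord0 : 'I_n.+1); rewrite card_ord /= => cn.
  rewrite -[X in (_ <= X)%N]cn.
  by apply/subset_leq_card/fintype.subsetP => _ /codomP[k ->]; rewrite inE.
rewrite /avoid0 card_inj_ffuns_on card_ord; congr (_ ^_ _).
by rewrite cardC1 card_ord.
Qed.

End exchangeable.

(** * The rank of the outlying variable *)

Definition binpmf (R : realType) (n : nat) (p : R) (k : nat) : R :=
  'C(n, k)%:R * p ^+ k * (1 - p) ^+ (n - k).

Lemma binpmf_continuous (R : realType) n k : continuous (fun p : R => binpmf n p
  k).
Proof.
move=> p; apply: cvgM.
  by apply: cvgM; [exact: cvg_cst|exact: exprn_continuous].
apply: (@cvg_comp _ _ _ (fun p => 1 - p) (fun q => q ^+ (n - k))).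
  by apply: cvgB; [exact: cvg_cst|exact: cvg_id].
exact: exprn_continuous.
Qed.

Section sample.
Context {R : realType} {d : measure_display} {Om : measurableType d}.
Variables (P : probability Om R) (n : nat) (X : 'I_n.+1 -> {RV P >-> R}).
Variables (mu0 sigma0 mu sigma : R).
Hypotheses (sigma0_gt0 : 0 < sigma0) (sigma_gt0 : 0 < sigma).
Hypothesis sampleX : normal_sample P X mu0 sigma0 mu sigma.

Local Notation x := (fun j => X j : Om -> R).
Local Notation F0 y := (Phi ((y - mu0) / sigma0)).
Local Notation F y := (Phi ((y - mu) / sigma)).

Let indep : mutually_independent P (fun j => X j : Om -> R).
Proof. by case: sampleX. Qed.

Lemma sample_same_law i k : i != ord0 -> k != ord0 ->
  forall B, measurable B -> P (X i @^-1` B) = P (X k @^-1` B).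
Proof.
case: sampleX => _ _ H i0 k0 B mB.
transitivity (normal_prob mu sigma B); first exact: H.
by apply/esym; exact: H.
Qed.

Lemma sample_atomless i y : P (X i @^-1` [set y]) = 0%E.
Proof.
case: sampleX => _ H0 H; have [->|i0] := eqVneq i ord0.
  by rewrite [LHS]H0// normal_prob_set1.
by rewrite [LHS]H// normal_prob_set1.
Qed.

Lemma measurable_RV_le i y : measurable [set w | X i w <= y].
Proof. by apply: measurable_set_le => //; exact: measurable_cst. Qed.

Lemma measurable_RV_itv i a b : measurable [set w | a < X i w <= b].
Proof.
rewrite [X in measurable X](_ : _ = ~` [set w | X i w <= a] `&` [set w | X i w
  <= b]).
  by apply: measurableI; [apply: measurableC|]; exact: measurable_RV_le.
apply/seteqP; split=> w /=; first by move=> /andP[aw ->]; split => //;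
  apply/negP; rewrite -ltNge.
by move=> [/negP + ->]; rewrite -ltNge => ->.
Qed.

Lemma pr_X0_le y : pr P [set w | X ord0 w <= y] = F0 y.
Proof.
case: sampleX => _ H0 _; apply: EFin_inj; rewrite prE; last exact:
  measurable_RV_le.
rewrite -normal_prob_halfline// -(H0 `]-oo, y]%classic)//.
Qed.

Lemma pr_Xj_le j y : j != ord0 -> pr P [set w | X j w <= y] = F y.
Proof.
case: sampleX => _ _ H j0; apply: EFin_inj; rewrite prE; last exact:
  measurable_RV_le.
rewrite -normal_prob_halfline// -(H j j0 `]-oo, y]%classic)//.
Qed.

Lemma pr_RV_itv i a b : a <= b -> pr P [set w | a < X i w <= b] =
  pr P [set w | X i w <= b] - pr P [set w | X i w <= a].
Proof.
move=> ab; apply/eqP; rewrite eq_sym subr_eq addrC -pr_setU.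
- apply/eqP; congr pr; apply/seteqP; split=> w /=.
    by have [wa|wa] := leP (X i w) a; [left|right].
  by move=> [wa|/andP[]//]; exact: le_trans ab.
- exact: measurable_RV_le.
- exact: measurable_RV_itv.
- by move=> w [/= wa /andP[]]; rewrite ltNge wa.
Qed.

Definition count_le (y : R) (w : Om) : nat :=
  #|[set l : 'I_n | X (lift ord0 l) w <= y]%SET|.

Lemma rank0_count w : rank x ord0 w = (count_le (X ord0 w) w).+1.
Proof.
rewrite /rank; transitivity (\sum_(j < n.+1) (X j w <= X ord0 w)%R)%N => //.
rewrite big_ord_recl lexx add1n; congr S.
rewrite /count_le -sum1_card [RHS]big_mkcond; apply: eq_bigr => l _.
by rewrite inE; case: (_ <= _).
Qed.

Lemma measurable_count_le y k : measurable [set w | count_le y w = k].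
Proof.
have := @measurable_bool_family _ Om _ (fun (l : 'I_n) w => X (lift ord0 l) w <=
  y)
  (fun c => #|[set l | c l]%SET| = k).
rewrite (_ : mkset _ = [set w | count_le y w = k]).
  by apply => l; exact: measurable_RV_le.
apply/funext => w; rewrite /mkset /count_le; congr (_ = _); apply: eq_card => l.
by rewrite !inE ffunE.
Qed.

(** Each of the [2 ^ n] patterns of comparisons with [y] is an intersection of
    independent events. *)
Lemma pr_count_le y k : pr P [set w | count_le y w = k] = binpmf n (F y) k.
Proof.
pose g w := [set l : 'I_n | X (lift ord0 l) w <= y]%SET.
have prg S : pr P [set w | g w = S] = F y ^+ #|S| * (1 - F y) ^+ (n - #|S|).
  pose B (j : 'I_n.+1) : set R := if unlift ord0 j is Some l then
    (if l \in S then [set` `]-oo, y]] else [set` `]y, +oo[]) else setT.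
  have mB j : measurable (B j) by rewrite /B; case: unlift => // l; case: ifP.
  have -> : [set w | g w = S] = [set w | forall j, B j (X j w)].
    apply/seteqP; split=> w /=.
      move=> gS j; rewrite /B -gS; case: unliftP => [l ->|->] //.
      by rewrite inE; case: leP => wy; rewrite /= in_itv/= ?wy.
    move=> Bw; apply/setP => l; rewrite inE; have := Bw (lift ord0 l).
    rewrite /B liftK; case: (l \in S); rewrite /= in_itv/= ?andbT//.
    by rewrite ltNge => /negbTE.
  apply: EFin_inj; rewrite prE; last first.
    by apply: (measurable_forall (A := fun j => X j @^-1` B j)) => j; exact:
      measurable_funPTI.
  rewrite (indep_box indep mB) big_ord_recl /B unlift_none preimage_setT
    probability_setT mul1e.
  transitivity (\prod_(l < n) (if l \in S then F y else 1 - F y)%:E)%E.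
    apply: eq_bigr => l _; rewrite liftK; case: ifP => _.
      rewrite -(@pr_Xj_le (lift ord0 l))// prE; last exact: measurable_RV_le.
      by congr (P _); apply/seteqP; split=> w; rewrite /preimage/= in_itv.
    rewrite -(@pr_Xj_le (lift ord0 l))// -pr_setC; last exact: measurable_RV_le.
    rewrite prE; last by apply: measurableC; exact: measurable_RV_le.
    congr (P _); apply/seteqP; split=> w; rewrite /preimage/= in_itv/= andbT
      ltNge.
      by move/negP.
    by move=> /negP.
  rewrite prodEFin; congr EFin.
  rewrite (bigID (mem S))/= -!prodr_const; congr (_ * _).
    by apply: eq_bigr => l ->.
  rewrite (_ : (n - #|S|)%N = #|~: S|); last by rewrite [RHS]cardsCs
    finset.setCK card_ord.
  rewrite -prodr_const; apply: eq_big => l; first by rewrite inE.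
  by move=> /negbTE ->.
rewrite (@pr_split _ _ _ _ _ (enum [set S : {set 'I_n} | #|S| == k]%SET) g)
  ?enum_uniq//.
- rewrite big_enum/= -[X in binpmf X]card_ord /binpmf -card_draws -mulrA
  mulr_natl -sumr_const.
  apply: eq_bigr => S; rewrite inE => /eqP Sk.
  rewrite card_ord -Sk -prg; congr pr; apply/seteqP; split=> [w []//|w /= gS].
  by split=> //; rewrite /count_le -/(g w) gS.
- move=> S; rewrite mem_enum inE => /eqP Sk; apply: measurableI.
    exact: measurable_count_le.
  have := @measurable_bool_family _ Om _ (fun (l : 'I_n) w => X (lift ord0 l) w
    <= y)
    (fun c => [set l | c l]%SET = S).
  rewrite (_ : mkset _ = [set w | g w = S]).
    by apply => l; exact: measurable_RV_le.
  apply/funext => w; rewrite /mkset /g; congr (_ = _); apply/setP => l.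
  by rewrite !inE ffunE.
- by move=> w; rewrite mem_enum inE => <-.
Qed.

(** When [X ord0] falls in an interval that the other variables avoid, its rank
    is read off from a threshold, and thresholds give binomial counts. *)
Lemma rank0_near_binomial a b k : a <= b ->
  `|pr P [set w | rank x ord0 w = k.+1] - binpmf n (F a) k| <=
  (1 - (F0 b - F0 a)) + n%:R * (F b - F a).
Proof.
move=> ab; rewrite -pr_count_le.
have mr : measurable [set w | rank x ord0 w = k.+1].
  have := @measurable_ranks _ _ Om n x (fun r => r ord0 = k.+1).
  rewrite (_ : mkset _ = [set w | rank x ord0 w = k.+1]); first by apply.
  by apply/funext => w; rewrite /mkset ffunE.
pose B1 := ~` [set w | a < X ord0 w <= b].
pose B2 := [set w | exists l : 'I_n, [set w | a < X (lift ord0 l) w <= b] w].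
have mB1 : measurable B1 by apply: measurableC; exact: measurable_RV_itv.
have mB2 : measurable B2.
  by apply: measurable_exists => l; exact: measurable_RV_itv.
apply: (@le_trans _ _ (pr P (B1 `|` B2))).
  apply: pr_near => //; [exact: measurable_count_le|exact: measurableU|].
  move=> w nB; have [/andP[aX0 X0b]|X0] := pselect (a < X ord0 w <= b); last
    first.
    by exfalso; apply: nB; left.
  suff rE : rank x ord0 w = (count_le a w).+1.
    by rewrite /= rE; split=> [[->]|->].
  rewrite rank0_count; congr S; apply: eq_card => l; rewrite !inE.
  apply/idP/idP => [Xl|/le_trans]; last by apply; exact: ltW.
  rewrite leNgt; apply/negP => aXl; apply: nB; right; exists l => /=.
  by rewrite aXl (le_trans Xl).
rewrite (le_trans (pr_setU_le _ _ _))// lerD//.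
  rewrite /B1 pr_setC; last exact: measurable_RV_itv.
  by rewrite pr_RV_itv// !pr_X0_le.
rewrite (le_trans (pr_exists_le _ _))//; first by move=> l; exact:
  measurable_RV_itv.
rewrite (eq_bigr (fun=> F b - F a)); last first.
  by move=> l _; rewrite pr_RV_itv// !pr_Xj_le.
by rewrite sumr_const card_ord mulr_natl.
Qed.

(** When the other variables concentrate in an interval that [X ord0] avoids,
    [X ord0] is either the smallest or the largest. *)
Lemma rank0_near_extreme a b v : (0 < n)%N -> a <= b ->
  `|pr P [set w | rank x ord0 w = v] -
    ((v == n.+1)%:R * (1 - F0 b) + (v == 1%N)%:R * F0 b)| <=
  (F0 b - F0 a) + n%:R * (1 - (F b - F a)).
Proof.
move=> n0 ab.
pose ext w : nat := if X ord0 w <= b then 1%N else n.+1.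
have mb : measurable [set w | X ord0 w <= b] by exact: measurable_RV_le.
have mext : measurable [set w | ext w = v].
  rewrite (_ : [set w | ext w = v] = [set w |
      (if [ffun _ : unit => X ord0 w <= b] tt then 1%N else n.+1) = v]).
    exact: (@measurable_bool_family _ Om unit (fun _ w => X ord0 w <= b)
      (fun c => (if c tt then 1%N else n.+1) = v)).
  by apply/funext => w; rewrite /mkset ffunE.
have <- : pr P [set w | ext w = v] =
    (v == n.+1)%:R * (1 - F0 b) + (v == 1%N)%:R * F0 b.
  have n1 : (1%N == n.+1) = false by rewrite eqSS eq_sym -leqn0 leqNgt n0.
  have [->|vn] := eqVneq v n.+1.
    rewrite eq_sym n1 mul1r mul0r addr0 -pr_X0_le -pr_setC//.
    congr pr; apply/seteqP; split=> w; rewrite /ext /=.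
      by case: ifP => // _ /eqP; rewrite n1.
    by case: ifP.
  have [->|v1] := eqVneq v 1%N.
    rewrite mul0r mul1r add0r -pr_X0_le.
    congr pr; apply/seteqP; split=> w; rewrite /ext /=; case: ifP => // _ /eqP.
    by rewrite eq_sym n1.
  rewrite !mul0r addr0 -(pr_set0 P); congr pr; rewrite -subset0 => w.
  by rewrite /ext/=; case: ifP => _ /esym/eqP; rewrite (negbTE vn, negbTE v1).
have mr : measurable [set w | rank x ord0 w = v].
  have := @measurable_ranks _ _ Om n x (fun r => r ord0 = v).
  rewrite (_ : mkset _ = [set w | rank x ord0 w = v]); first by apply.
  by apply/funext => w; rewrite /mkset ffunE.
pose B1 := [set w | a < X ord0 w <= b].
pose B2 := [set w | exists l : 'I_n, (~` [set w | a < X (lift ord0 l) w <= b])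
  w].
have mB1 : measurable B1 by exact: measurable_RV_itv.
have mB2 : measurable B2.
  apply: (measurable_exists (A := fun l => ~` [set w | a < X (lift ord0 l) w <=
    b])) => l.
  by apply: measurableC; exact: measurable_RV_itv.
apply: (@le_trans _ _ (pr P (B1 `|` B2))).
  apply: pr_near => //; first exact: measurableU.
  move=> w nB; suff rE : rank x ord0 w = ext w by rewrite /= rE.
  have Xl l : a < X (lift ord0 l) w <= b.
    by apply: contrapT => Xl; apply: nB; right; exists l.
  rewrite rank0_count /ext; case: leP => X0b.
    congr S; apply/eqP; rewrite cards_eq0; apply/eqP/setP => l; rewrite !inE.
    apply/negbTE; rewrite -ltNge; have /andP[+ _] := Xl l.
    apply: le_lt_trans; rewrite leNgt; apply/negP => aX0.
    by apply: nB; left; rewrite /B1 /= aX0.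
  congr S; rewrite -[RHS]card_ord; apply: eq_card => l; rewrite !inE.
  by have /andP[_ /le_trans->//] := Xl l; exact: ltW.
rewrite (le_trans (pr_setU_le _ _ _))// lerD//.
  by rewrite /B1 pr_RV_itv// !pr_X0_le.
rewrite (le_trans (pr_exists_le P
  (A := fun l => ~` [set w | a < X (lift ord0 l) w <= b]) _))//.
  by move=> l; apply: measurableC; exact: measurable_RV_itv.
rewrite (eq_bigr (fun=> 1 - (F b - F a))); last first.
  move=> l _; rewrite pr_setC; last exact: measurable_RV_itv.
  by rewrite pr_RV_itv// !pr_Xj_le.
by rewrite sumr_const card_ord mulr_natl.
Qed.
End sample.

(** * Convergence of the ranks for a fixed sample size *)

Lemma affine_standardize (R : realType) (a b c e K : R) : 0 < b -> 0 < e ->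
  (a + K * b - c) / e = (K - (c - a) / b) / (e / b).
Proof. by move=> b0 e0; field; rewrite !gt_eqF. Qed.

Lemma half_tail (R : realType) (u e : R) : 1 - e / 8 < u ->
  1 - (u - (1 - u)) < e / 4.
Proof. by move=> ?; lra. Qed.

Lemma dist_trans4 (R : realType) (p q z a b e : R) : `|p - q| <= a + b ->
  a < e / 4 -> b < e / 4 -> `|z - q| < e / 4 -> `|z - p| < e.
Proof.
by rewrite ler_norml => /andP[? ?] ? ?; rewrite !ltr_norml => /andP[? ?]; lra.
Qed.

Section fixed_size.
Context {R : realType} {T : Type} {F : set_system T} {FF : ProperFilter F}.
Variables (m n : nat) (mu0 sigma0 mu sigma : T -> R).
Context {d : T -> measure_display} {Om : forall t, measurableType (d t)}.
Variables (P : forall t, probability (Om t) R)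
  (X : forall t, 'I_n.+1 -> {RV (P t) >-> R}) (i : T -> 'I_m -> 'I_n.+1).
Hypotheses (sigma0_gt0 : forall t, 0 < sigma0 t)
  (sigma_gt0 : forall t, 0 < sigma t).
Hypothesis sampleX : forall t,
  normal_sample (P t) (X t) (mu0 t) (sigma0 t) (mu t) (sigma t).
Hypotheses (i_inj : forall t, injective (i t))
  (i_neq0 : forall t k, i t k != ord0).

Local Notation x t := (fun j => X t j : Om t -> R).
Local Notation delta t := ((mu t - mu0 t) / sigma0 t).
Local Notation rho t := (sigma t / sigma0 t).

Lemma standardize0 (t : T) (K : R) :
  (mu0 t + K * sigma0 t - mu0 t) / sigma0 t = K.
Proof. by rewrite addrAC subrr add0r mulfK// gt_eqF. Qed.

Lemma standardize1 (t : T) (K : R) :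
  (mu0 t + K * sigma0 t - mu t) / sigma t = (K - delta t) / rho t.
Proof.
exact: affine_standardize.
Qed.

(** If every point at a bounded number of standard deviations of [X ord0] has
    the same limiting level [z] for the other variables, then [X ord0] acts as a
    threshold of level [z]. *)
Lemma cvg_rank0_binomial (z : R) :
  (forall K : R, Phi ((K - delta t) / rho t) @[t --> F] --> z) ->
  forall k, pr (P t) [set w | rank (x t) ord0 w = k.+1] @[t --> F]
    --> binpmf n z k.
Proof.
move=> Fz k; apply/cvgrPdist_lt => e e0.
have e4 : 0 < e / 4 by rewrite divr_gt0.
(* [X ord0] is within [K] standard deviations of its mean with high
   probability. *)
have [K [K0 HK]] : exists K : R, 0 <= K /\ 1 - (Phi K - Phi (- K)) < e / 4.
  have [K [K0 HK]] : exists K : R, 0 <= K /\ 1 - e / 8 < Phi K.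
    near (+oo : set_system R)%R => K; exists K; split; near: K.
      by apply: nbhs_pinfty_ge; exact: num_real.
    apply: (cvgr_gt _ (@Phi_cvg_pinfty R)).
    by rewrite ltrBlDr ltrDl divr_gt0.
  by exists K; split=> //; rewrite PhiN half_tail.
pose Fa t := Phi ((- K - delta t) / rho t).
pose Fb t := Phi ((K - delta t) / rho t).
have cFa : binpmf n (Fa t) k @[t --> F] --> binpmf n z k.
  exact: (cvg_comp _ _ (Fz _) (@binpmf_continuous R n k z)).
near=> t.
have ab : mu0 t + - K * sigma0 t <= mu0 t + K * sigma0 t.
  by rewrite lerD2l ler_pM2r// (le_trans _ K0)// oppr_le0.
have := rank0_near_binomial (sigma0_gt0 t) (sigma_gt0 t) (sampleX t) k ab.
rewrite !standardize0 !standardize1 -/(Fa t) -/(Fb t) => H.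
have H1 : `|binpmf n z k - binpmf n (Fa t) k| < e / 4.
  by near: t; move/cvgrPdist_lt : cFa; exact.
have H2 : n%:R * (Fb t - Fa t) < e / 4.
  near: t; apply: (cvgr_lt (n%:R * (z - z))); last by rewrite subrr mulr0.
  by apply: cvgM; [exact: cvg_cst|apply: cvgB; exact: Fz].
exact: dist_trans4 H HK H2 H1.
Unshelve. all: end_near. Qed.

(** As [rho] vanishes, the other variables concentrate at distance [delta0] (in
    units of [sigma0]) from the mean of [X ord0], which lies below them all or
    above them all according to its side of that point. *)
Lemma cvg_rank0_extreme (delta0 : R) : (0 < n)%N ->
  (forall t, delta t = delta0) -> (fun t => rho t) @ F --> 0^'+ ->
  forall v, pr (P t) [set w | rank (x t) ord0 w = v] @[t --> F]
    --> (v == n.+1)%:R * Phi (- delta0) + (v == 1%N)%:R * (1 - Phi (- delta0)).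
Proof.
move=> n0 deltaE rho0 v.
pose lim u := (v == n.+1)%:R * (1 - Phi u) + (v == 1%N)%:R * Phi u : R.
rewrite (_ : _ + _ = lim delta0); last by rewrite /lim PhiN subKr.
apply/cvgrPdist_lt => e e0.
have e4 : 0 < e / 4 by rewrite divr_gt0.
have lim_cont : continuous lim.
  move=> u; apply: cvgD; (apply: cvgM; first exact: cvg_cst).
    by apply: cvgB; [exact: cvg_cst|exact: Phi_continuous].
  exact: Phi_continuous.
(* [X ord0] falls within [h * sigma0] of the mean [mu] of the other variables
   with small probability. *)
have [h [h0 Hh1 Hh2]] : exists h : R, [/\ 0 < h,
    Phi (delta0 + h) - Phi (delta0 - h) < e / 4 &
    `|lim delta0 - lim (delta0 + h)| < e / 4].
  have c0 : h @[h --> (0 : R)^'+] --> (0 : R).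
    by apply: cvg_at_right_filter; exact: cvg_id.
  have cD : delta0 + h @[h --> (0 : R)^'+] --> delta0.
    by rewrite -[X in _ --> X]addr0; apply: cvgD; [exact: cvg_cst|exact: c0].
  have cB : delta0 - h @[h --> (0 : R)^'+] --> delta0.
    by rewrite -[X in _ --> X]subr0; apply: cvgB; [exact: cvg_cst|exact: c0].
  near ((0 : R)^'+) => h; exists h; split; near: h; first exact: nbhs_right_gt.
    apply: (cvgr_lt (Phi delta0 - Phi delta0)); last by rewrite subrr.
    apply: cvgB; first exact: (cvg_comp _ _ cD (@Phi_continuous R delta0)).
    exact: (cvg_comp _ _ cB (@Phi_continuous R delta0)).
  have clim : lim (delta0 + h) @[h --> (0 : R)^'+] --> lim delta0.
    exact: (cvg_comp _ _ cD (lim_cont delta0)).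
  by move/cvgrPdist_lt : clim; exact.
pose G t := Phi (h / rho t); pose G' t := Phi (- h / rho t).
have rho_gt0 t : 0 < rho t by rewrite divr_gt0.
have Vrho : (rho t)^-1 @[t --> F] --> +oo.
  apply/cvgrVy; first by near=> t; exact: rho_gt0.
  by apply: cvg_trans rho0 _; exact: cvg_within.
have cG : G t @[t --> F] --> (1 : R).
  have hy : h / rho t @[t --> F] --> +oo.
    exact: (cvg_comp _ _ Vrho (gt0_cvgMry h0 cvg_id)).
  exact: (cvg_comp _ _ hy (@Phi_cvg_pinfty R)).
have cG' : G' t @[t --> F] --> (0 : R).
  rewrite (_ : G' = (fun t => 1 - G t)); last first.
    by apply/funext => t; rewrite /G' /G mulNr PhiN.
  by rewrite -(subrr 1); apply: cvgB; [exact: cvg_cst|].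
near=> t.
have ab : mu0 t + (delta0 - h) * sigma0 t <= mu0 t + (delta0 + h) * sigma0 t.
  by rewrite lerD2l ler_pM2r// lerD2l ge0_cp// ltW.
have := rank0_near_extreme (sigma0_gt0 t) (sigma_gt0 t) (sampleX t) v n0 ab.
rewrite !standardize0 !standardize1 deltaE -/(lim _).
rewrite !(addrAC delta0 _ (- delta0)) subrr !add0r -/(G t) -/(G' t) => H.
have H2 : n%:R * (1 - (G t - G' t)) < e / 4.
  near: t; apply: (cvgr_lt (n%:R * (1 - (1 - 0)))); last by rewrite subr0 subrr
    mulr0.
  apply: cvgM; first exact: cvg_cst.
  by apply: cvgB; [exact: cvg_cst|exact: cvgB].
exact: dist_trans4 H Hh1 H2 Hh2.
Unshelve. all: end_near. Qed.

(** Only the law of the rank of [X ord0] depends on the parameters. *)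
Lemma cvg_rank_tuple (q : nat -> R) (d' : measure_display)
    (Om' : measurableType d') (P' : probability Om' R)
    (Y : Om' -> m.+1.-tuple nat) :
  (forall v, (1 <= v <= n.+1)%N ->
    pr (P t) [set w | rank (x t) ord0 w = v] @[t --> F] --> q v) ->
  (forall c, measurable [set w | Y w = c]) ->
  (forall c, pr P' [set w | Y w = c] =
    if c \in distinct_tuples n.+1 m.+1
    then q (tnth c ord0) / (n ^_ m)%:R else 0) ->
  cvg_in_distribution F P
    (fun t w => cons_rV (rank (x t) ord0 w)%:R
                  (fun k => (rank (x t) (i t k) w)%:R)) P'
    (fun w => \row_k (tnth (Y w) k)%:R).
Proof.
move=> cq mY YE f _ [M fM].
pose h (c : m.+1.-tuple nat) := f (\row_k (tnth c k)%:R).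
have hE t : f \o (fun w => cons_rV (rank (x t) ord0 w)%:R
      (fun k => (rank (x t) (i t k) w)%:R)) =
    (fun w => h (rank_tuple (x t) (i t) w)).
  apply/funext => w; rewrite /h /=; congr f; apply/rowP => k; rewrite !mxE.
  by case: unliftP => [l ->|->]; rewrite /rank_tuple ?tnthS ?tnth_mktuple//
    tnth0.
rewrite (_ : (fun t => _) =
    (fun t => 'E_(P t)[fun w => h (rank_tuple (x t) (i t) w)]%E)); last first.
  by apply/funext => t; rewrite hE.
pose s : seq (m.+1.-tuple nat) :=
  [seq map_tuple (@nat_of_ord n.+2) c | c : m.+1.-tuple 'I_n.+2].
apply: (@cvg_expectation_finite _ _ _ _ _ s _ _ _
  (fun t w => rank_tuple (x t) (i t) w) _ _ P' Y h M).
- rewrite map_inj_uniq ?enum_uniq// => c e /(congr1 val)/= ce.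
  by apply/val_inj/(inj_map (@ord_inj n.+2)).
- by move=> t c; exact: measurable_rank_tuple.
- move=> t w; apply/mapP => /=.
  have r_lt k : (tnth (rank_tuple (x t) (i t) w) k < n.+2)%N.
    case: (unliftP ord0 k) => [l ->|->].
      by rewrite /rank_tuple tnthS tnth_mktuple ltnS rank_le.
    by rewrite /rank_tuple tnth0 ltnS rank_le.
  exists [tuple Ordinal (r_lt k) | k < m.+1]; first by rewrite mem_enum.
  by apply: eq_from_tnth => k; rewrite tnth_map tnth_mktuple.
- exact: mY.
- move=> c _; rewrite YE.
  have lawE t : pr (P t) [set w | rank_tuple (x t) (i t) w = c] =
      if c \in distinct_tuples n.+1 m.+1
      then pr (P t) [set w | rank (x t) ord0 w = tnth c ord0] / (n ^_ m)%:R else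
        0.
    apply: rank_tuple_law => //.
    - by case: (sampleX t).
    - exact: sample_same_law (sampleX t).
    - exact: sample_atomless (sigma0_gt0 t) (sigma_gt0 t) (sampleX t).
  rewrite (funext lawE); case: ifPn => [/mem_distinct_tuples[cb _]|_].
    by apply: cvgM; [exact: cq|exact: cvg_cst].
  exact: cvg_cst.
- by move=> c; exact: fM.
Qed.

End fixed_size.

(** * Laws on distinct tuples *)

Lemma card_distinct_tuples (n m : nat) :
  #|` fset_set (distinct_tuples n m)|%fset = n ^_ m.
Proof.
pose J := [set f : {ffun 'I_m -> 'I_n} | injectiveb f]%SET.
pose tup (f : {ffun 'I_m -> 'I_n}) : m.-tuple nat := [tuple (f k).+1 | k < m].
have -> : distinct_tuples n m = [set` [fset x in [seq tup f | f <- enum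
  J]]%fset].
  apply/seteqP; split=> v.
    move=> /(@mem_set _ _ v)/mem_distinct_tuples[vb vi] /=; rewrite inE /=.
    have v_lt k : ((tnth v k).-1 < n)%N.
      by have /andP[v0 vn] := vb k; rewrite prednK.
    apply/mapP; exists [ffun k => Ordinal (v_lt k)].
      rewrite mem_enum inE; apply/injectiveP => k l; rewrite !ffunE => -[] kl.
      by apply: vi; have /andP[k0 _] := vb k; have /andP[l0 _] := vb l;
        rewrite -(prednK k0) kl prednK.
    apply: eq_from_tnth => k; rewrite tnth_mktuple ffunE /= prednK//.
    by have /andP[] := vb k.
  rewrite /= inE /= => /mapP[f]; rewrite mem_enum inE => /injectiveP fi ->.
  apply: set_mem; apply/mem_distinct_tuples; split=> [k|k l].
    by rewrite tnth_mktuple /=.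
  by rewrite !tnth_mktuple => -[] /val_inj/fi.
rewrite set_fsetK card_fseq undup_id.
  by rewrite size_map -cardE card_inj_ffuns !card_ord.
rewrite map_inj_uniq ?enum_uniq// => f g fg; apply/ffunP => k; apply/val_inj.
by have := congr1 (fun v => tnth v k) fg; rewrite !tnth_mktuple => -[].
Qed.

Lemma prod_falling (R : realType) (n m : nat) : (m <= n)%N ->
  \prod_(1 <= i < m.+1) (n - i + 1)%N%:R = (n ^_ m)%:R :> R.
Proof.
move=> mn; rewrite ffact_prod natr_prod big_add1 big_mkord.
by apply: eq_bigr => i _; rewrite subnS addn1 prednK// subn_gt0 (leq_trans
  (ltn_ord i)).
Qed.

Lemma measurable_nat_tuples m (A : set (m.-tuple nat)) : measurable A.
Proof.
apply: (@measurable_fibers _ _ (m.-tuple nat) id A) => u.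
rewrite [X in measurable X](_ : _ = [set z | forall k, tnth z k = tnth u k]).
  apply: (measurable_forall
    (A := fun k => (fun z : m.-tuple nat => tnth z k) @^-1` [set tnth u k])) =>
      k.
  by rewrite -[_ @^-1` _]setTI; exact: measurable_tnth.
by apply/seteqP; split=> [z /= ->//|z zu]; exact: eq_from_tnth.
Qed.

Section tuple_valued.
Context {R : realType} {d : measure_display} {Om : measurableType d}
  {P : probability Om R}.

Lemma measurable_tuple_map (C : Type) m (U : {RV P >-> m.-tuple nat})
  (h : m.-tuple nat -> C) c : measurable [set w | h (U w) = c].
Proof.
rewrite (_ : mkset _ = U @^-1` [set u | h u = c])//.
by apply: measurable_funPTI; exact: measurable_nat_tuples.
Qed.

Lemma pr_uniform_on n m (U : {RV P >-> m.-tuple nat}) u :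
  uniform_on P (distinct_tuples n m) U ->
  pr P [set w | U w = u] =
  if u \in distinct_tuples n m then (n ^_ m)%:R^-1 else 0.
Proof. by move=> HU; rewrite /pr [P _]HU card_distinct_tuples. Qed.

Lemma pr_V_law n m z (V : {RV P >-> m.+1.-tuple nat}) v : (m <= n)%N ->
  V_law P n z V ->
  pr P [set w | V w = v] =
  if v \in distinct_tuples n.+1 m.+1
  then binpmf n z (tnth v ord0).-1 / (n ^_ m)%:R else 0.
Proof.
move=> mn HV; rewrite /pr [P _]HV; case: ifP => // /mem_distinct_tuples[vb _].
rewrite /= prod_falling// /binpmf; congr (_ * _ ^+ _ / _).
by have /andP[v0 _] := vb ord0; rewrite -{1}(prednK v0) subSS.
Qed.

End tuple_valued.

Lemma mem_distinct_tuplesE (n m : nat) (v : m.-tuple nat) :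
  (v \in distinct_tuples n m) = all (fun x => 1 <= x <= n)%N v && uniq v.
Proof. by apply/idP/idP; rewrite inE. Qed.

(** Around an extreme entry, the remaining entries range over the distinct
    tuples of one size less, shifted by one when the extreme is the minimum. *)
Lemma distinct_tuples_cons_max (n m : nat) (u : m.-tuple nat) :
  ([tuple of n.+1 :: u] \in distinct_tuples n.+1 m.+1) =
  (u \in distinct_tuples n m).
Proof.
rewrite !mem_distinct_tuplesE /= leqnn /= andbA; congr (_ && _).
elim: (tval u) => //= a s IH; rewrite in_cons negb_or -IH.
rewrite andbACA; congr (_ && _); case: a => [|a] //=.
by rewrite eqSS eq_sym andbC ltnS -ltn_neqAle.
Qed.

Lemma distinct_tuples_cons_min (n m : nat) (u : m.-tuple nat) :
  ([tuple of 1%N :: map_tuple S u] \in distinct_tuples n.+1 m.+1) =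
  (u \in distinct_tuples n m).
Proof.
rewrite !mem_distinct_tuplesE /= (map_inj_uniq succn_inj) andbA; congr (_ && _).
elim: (tval u) => //= a s IH; rewrite in_cons negb_or -IH andbACA.
by congr (_ && _); rewrite eqSS ltnS lt0n eq_sym andbC.
Qed.

Section uniform_tuples.
Context {R : realType} {d : measure_display} {Om : measurableType d}
  {P : probability Om R}.
Variables (n m : nat) (U : {RV P >-> m.-tuple nat}).
Hypothesis uniU : uniform_on P (distinct_tuples n m) U.

(** Stated in the shape of [cvg_rank_tuple]: a law of the first entry, times the
    uniform law of the others given the first. *)
Lemma pr_cons_max c : pr P [set w | [tuple of n.+1 :: U w] = c] =
  if c \in distinct_tuples n.+1 m.+1
  then (tnth c ord0 == n.+1)%:R / (n ^_ m)%:R else 0.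
Proof.
have [c0|c0] := eqVneq (tnth c ord0) n.+1; last first.
  rewrite mul0r if_same -(pr_set0 P); congr pr; rewrite -subset0 => w /= Uc.
  by rewrite -Uc tnth0 eqxx in c0.
rewrite mul1r (tuple_eta c) /thead c0 distinct_tuples_cons_max.
rewrite -(pr_uniform_on _ uniU); congr pr; apply/seteqP; split=> w /=.
  by move=> /(congr1 val)[Uc]; apply: val_inj.
by move=> ->.
Qed.

Lemma pr_cons_min c : pr P [set w | [tuple of 1%N :: map_tuple S (U w)] = c] =
  if c \in distinct_tuples n.+1 m.+1
  then (tnth c ord0 == 1%N)%:R / (n ^_ m)%:R else 0.
Proof.
have [c0|c0] := eqVneq (tnth c ord0) 1%N; last first.
  rewrite mul0r if_same -(pr_set0 P); congr pr; rewrite -subset0 => w /= Uc.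
  by rewrite -Uc tnth0 eqxx in c0.
have [[u cu]|nu] := pselect (exists u, behead_tuple c = map_tuple S u).
  have cE : c = [tuple of 1%N :: map_tuple S u].
    rewrite (tuple_eta c) /thead c0; apply: val_inj => /=.
    by have /= -> := congr1 val cu.
  rewrite mul1r cE distinct_tuples_cons_min -(pr_uniform_on _ uniU); congr pr.
  apply/seteqP; split=> w /=.
    by move=> /(congr1 val)[/(inj_map succn_inj)]; apply: val_inj.
  by move=> ->.
rewrite ifN.
  rewrite -(pr_set0 P); congr pr; rewrite -subset0 => w /= Uc; apply: nu.
  by exists (U w); rewrite -Uc; exact: val_inj.
apply/negP => /mem_distinct_tuples[cb _]; apply: nu.
exists (map_tuple predn (behead_tuple c)); apply: eq_from_tnth => k.
rewrite !tnth_map tnth_behead prednK//.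
by have /andP[] := cb (inord k.+1).
Qed.
End uniform_tuples.

(** * Continuous functions of row vectors *)

Section row_vectors.
Variables (R : realType) (k : nat).
Implicit Types (f : 'rV[R]_k.+1 -> R) (u v : 'rV[R]_k.+1).

Lemma rV_norm_lt u (e : R) : 0 < e -> (forall j, `|u ord0 j| < e) -> `|u| < e.
Proof.
move=> e0 ue; rewrite [ `|u|]mx_normrE; apply/bigmax_ltP; split=> // -[a j] _
  /=.
by rewrite (ord1 a).
Qed.

Let cube := [set u : 'rV[R]_k.+1 | forall j, [set` `[0 : R, 1]] (u ord0 j)].

(** Heine's theorem, with only [u] confined to the cube. *)
Lemma cube_uniform_continuity f (e : R) : continuous f -> 0 < e ->
  exists2 r, 0 < r & forall u v, (forall j, 0 <= u ord0 j <= 1) ->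
    (forall j, `|u ord0 j - v ord0 j| < r) -> `|f u - f v| <= e.
Proof.
move=> fc e0.
have cK : compact cube.
  by apply: (@rV_compact R k.+1 (fun=> [set` `[0 : R, 1]])) => j; exact:
    segment_compact.
move/compact_near_coveringP : cK => /(_ R (0 : R)^'+
  (fun r u => forall v, `|u - v| < r -> `|f u - f v| < e)).
move=> /(_ _) H.
have {H} : \forall r \near (0 : R)^'+, cube `<=`
    (fun u => forall v, `|u - v| < r -> `|f u - f v| < e).
  apply: H => u _.
  have e2 : 0 < e / 2 by rewrite divr_gt0.
  have /cvgrPdist_lt/(_ _ e2)/nbhs_ballP[s /= s0 Hs] := fc u.
  have s2 : 0 < s / 2 by rewrite divr_gt0.
  exists (ball u (s / 2), [set r | r < s / 2]) => /=.
    by split; [exact: nbhsx_ballx|exact: nbhs_right_lt].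
  move=> [u' r] /= [uu' rs] v u'v.
  have uv : `|f u - f v| < e / 2.
    apply: Hs; rewrite mx_norm_ball /ball_ /=.
    rewrite (splitr s) -(subrKA u') (le_lt_trans (ler_normD _ _))// ltrD//.
      by move: uu'; rewrite mx_norm_ball.
    exact: lt_trans u'v rs.
  have uu : `|f u - f u'| < e / 2.
    apply: Hs; move: uu'; rewrite !mx_norm_ball /ball_ /= => /lt_trans; apply.
    by rewrite ltr_pdivrMr// ltr_pMr// ltr1n.
  rewrite (splitr e) -(subrKA (f u)) (le_lt_trans (ler_normD _ _))// ltrD//.
  by rewrite distrC.
move=> H; near (0 : R)^'+ => r; exists r => [//|u v u01 uv].
apply/ltW; have H' := @rV_norm_lt (u - v).
have : cube `<=` (fun u => forall v, `|u - v| < r -> `|f u - f v| < e) by near: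
  r.
apply; first by move=> j; rewrite /= in_itv/=.
apply: H' => // j; by rewrite !mxE.
Unshelve. all: end_near. Qed.

(** A pointwise limit of functions of the countably valued roundings
    [floor (N.+1 * V j) / N.+1]. *)
Lemma measurable_fun_continuous_row (d : measure_display)
    (Om : measurableType d)
    f (V : 'I_k.+1 -> Om -> R) :
  continuous f -> (forall j, measurable_fun setT (V j)) ->
  measurable_fun setT (fun w => f (\row_j V j w)).
Proof.
move=> fc mV.
pose g (N : nat) w : {ffun 'I_k.+1 -> int} :=
  [ffun j => Num.floor (N.+1%:R * V j w)].
pose h N (c : {ffun 'I_k.+1 -> int}) := f (\row_j ((c j)%:~R / N.+1%:R)).
apply: (@measurable_fun_cvg _ _ _ _ (fun N => h N \o g N)) => [N|w _].
  apply: measurable_fun_fibers => c.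
  rewrite [X in measurable X](_ : _ = [set w | forall j,
      [set w | (c j)%:~R <= N.+1%:R * V j w < (c j + 1)%:~R] w]); last first.
    apply/seteqP; split=> w /=.
      by move=> <- j; rewrite ffunE; exact: floor_itv.
    by move=> H; apply/ffunP => j; rewrite ffunE; exact: floor_def.
  apply: (@measurable_forall _ Om _ (fun j => [set w | (c j)%:~R <= N.+1%:R * V
    j w < (c j + 1)%:~R])) => j.
  have mNV : measurable_fun setT (fun w => N.+1%:R * V j w) by exact:
    measurable_funM.
  rewrite [X in measurable X](_ : _ =
      [set w | (c j)%:~R <= N.+1%:R * V j w] `&`
      ~` [set w | (c j + 1)%:~R <= N.+1%:R * V j w]).
    apply: measurableI; last apply: measurableC; exact: measurable_set_le.
  apply/seteqP; split=> w /=; first by move=> /andP[-> +]; rewrite ltNge =>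
    /negP.
  by move=> [-> /negP]; rewrite -ltNge.
apply: (@cvg_comp _ _ _ (fun N => \row_j ((g N w j)%:~R / N.+1%:R)) f _
  (nbhs (\row_j V j w)) _ _ (fc _)).
apply/cvg_ballP => e e0; near=> N; rewrite mx_norm_ball /ball_ /=.
apply: rV_norm_lt => // j; rewrite !mxE ffunE.
have N0 : 0 < N.+1%:R :> R by [].
have -> : V j w - (Num.floor (N.+1%:R * V j w))%:~R / N.+1%:R =
    (N.+1%:R * V j w - (Num.floor (N.+1%:R * V j w))%:~R) / N.+1%:R.
  by rewrite mulrBl mulrAC divff ?mul1r// lt0r_neq0.
rewrite normrM.
rewrite [ `|N.+1%:R^-1|]gtr0_norm ?invr_gt0// ltr_pdivrMr//.
have /andP[fl lf] := floor_itv (N.+1%:R * V j w).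
rewrite ger0_norm ?subr_ge0//.
apply: (@lt_trans _ _ 1).
  by rewrite ltrBlDl -intrD1.
rewrite -ltr_pdivrMr// div1r; near: N.
exact: (near_infty_natSinv_lt (PosNum e0)).
Unshelve. all: end_near. Qed.

End row_vectors.

(** * Quantization of the unit interval *)

(** [quant N x / N] rounds [x] up to the grid of step [1 / N]; counting grid
    points keeps the value between [0] and [N] for every real [x]. *)
Definition quant (R : realType) (N : nat) (x : R) : nat :=
  #|[pred k : 'I_N | k%:R / N%:R < x]|.

Section quant.
Variable R : realType.
Implicit Types x : R.

Lemma quant_max N x : (quant N x <= N)%N.
Proof. by rewrite -[X in (_ <= X)%N]card_ord max_card. Qed.

Let card_lt N c : (c <= N)%N -> #|[pred k : 'I_N | (k < c)%N]| = c.
Proof.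
move=> cN; rewrite -sum1_card -(big_ord_widen N (fun=> 1%N) cN).
by rewrite sum1_card card_ord.
Qed.

Lemma quant_leE N c x : (c < N)%N -> (quant N x <= c)%N = (x <= c%:R / N%:R).
Proof.
move=> cN; have N0 : 0 < N%:R :> R by rewrite ltr0n (leq_ltn_trans _ cN).
apply/idP/idP => [qc|xc].
  rewrite leNgt; apply/negP => cx; move: qc; apply/negP; rewrite -ltnNge.
  rewrite -{1}(card_lt cN); apply/subset_leq_card/fintype.subsetP => k.
  rewrite !inE ltnS => kc; apply: le_lt_trans cx.
  by rewrite ler_pM2r ?invr_gt0// ler_nat.
rewrite -[X in (_ <= X)%N](card_lt (ltnW cN));
  apply/subset_leq_card/fintype.subsetP => k.
rewrite !inE => /lt_le_trans/(_ xc).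
by rewrite ltr_pM2r ?invr_gt0// ltr_nat.
Qed.

Lemma quant_gt N k x : (k < quant N x)%N -> k%:R / N%:R < x.
Proof.
move=> kq; rewrite ltNge -quant_leE; first by rewrite -ltnNge.
exact: leq_trans kq (quant_max _ _).
Qed.

Lemma quant_ge N x : (0 < N)%N -> x <= 1 -> x <= (quant N x)%:R / N%:R.
Proof.
move=> N0 x1; have := quant_max N x; rewrite leq_eqVlt => /predU1P[->|qN].
  by rewrite divff// pnatr_eq0 -lt0n.
by rewrite -quant_leE.
Qed.

Lemma quant_dist N x : (0 < N)%N -> 0 <= x <= 1 ->
  `|x - (quant N x)%:R / N%:R| <= N%:R^-1.
Proof.
move=> N0 /andP[x0 x1]; have N0' : 0 < N%:R :> R by rewrite ltr0n.
have lb : (quant N x)%:R / N%:R <= x + N%:R^-1.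
  case q0 : (quant N x) => [|q]; first by rewrite mul0r addr_ge0// invr_ge0 ltW.
  rewrite -lerBlDr -[X in _ - X]mul1r -mulrBl -natr1 addrK ltW//.
  by apply: quant_gt; rewrite q0.
by rewrite distrC ger0_norm ?subr_ge0 ?quant_ge// lerBlDl.
Qed.

Lemma measurable_quant (d : measure_display) (Om : measurableType d)
    (U : Om -> R) N (Q : nat -> Prop) : measurable_fun setT U ->
  measurable [set w | Q (quant N (U w))].
Proof.
move=> mU.
have := @measurable_bool_family _ Om _ (fun (k : 'I_N) w => k%:R / N%:R < U w)
  (fun c => Q #|[pred k | c k]|).
rewrite (_ : mkset _ = [set w | Q (quant N (U w))]).
  apply => k.
  rewrite [X in measurable X](_ : _ = ~` [set w | U w <= k%:R / N%:R]).
    by apply/measurableC/measurable_set_le => //; exact: measurable_cst.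
  by apply/seteqP; split=> w /=; [move=> kU; apply/negP; rewrite -ltNge|
    move=> /negP; rewrite -ltNge].
apply/funext => w; rewrite /mkset /quant; congr (Q _); apply: eq_card => k.
by rewrite !inE ffunE.
Qed.

(** Quantized laws are read off from the distribution function on the unit
    interval. *)
Lemma quant_same_law (d d' : measure_display) (Om : measurableType d)
    (Om' : measurableType d') (P : probability Om R) (P' : probability Om' R)
    (U : Om -> R) (U' : Om' -> R) N :
  measurable_fun setT U -> measurable_fun setT U' ->
  (forall u, 0 <= u < 1 ->
     pr P [set w | U w <= u] = pr P' [set w | U' w <= u]) ->
  forall c, pr P [set w | quant N (U w) = c] = pr P' [set w | quant N (U' w) =
    c].
Proof.
move=> mU mU' UU'.
have D c : pr P [set w | (quant N (U w) <= c)%N] =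
    pr P' [set w | (quant N (U' w) <= c)%N].
  have [Nc|cN] := leqP N c.
    rewrite (_ : mkset _ = setT) ?pr_setT; last first.
      by apply/seteqP; split=> w //= _; exact: leq_trans (quant_max _ _) Nc.
    rewrite (_ : mkset _ = setT) ?pr_setT//.
    by apply/seteqP; split=> w //= _; exact: leq_trans (quant_max _ _) Nc.
  rewrite (_ : mkset _ = [set w | U w <= c%:R / N%:R]); last first.
    by apply/funext => w; rewrite /mkset quant_leE.
  rewrite (_ : mkset (fun w => is_true (quant _ _ <= _)%N) = [set w | U' w <=
    c%:R / N%:R]); last first.
    by apply/funext => w; rewrite /mkset quant_leE.
  have N0 : 0 < N%:R :> R by rewrite ltr0n (leq_ltn_trans _ cN).
  by apply: UU'; rewrite divr_ge0//= ltr_pdivrMr// mul1r ltr_nat.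
have split_eq (e : measure_display) (O : measurableType e) (Pr : probability O
  R)
    (V : O -> R) c : measurable_fun setT V ->
    pr Pr [set w | quant N (V w) = c.+1] =
    pr Pr [set w | (quant N (V w) <= c.+1)%N] -
    pr Pr [set w | (quant N (V w) <= c)%N].
  move=> mV; apply/eqP; rewrite eq_sym subr_eq addrC -pr_setU.
  - apply/eqP; congr pr; apply/seteqP; split=> w /=.
      by rewrite leq_eqVlt => /predU1P[->|]; [right|left].
    by move=> [/leqW//|->].
  - exact: (measurable_quant N (fun q => (q <= c)%N) mV).
  - exact: (measurable_quant N (fun q => q = c.+1) mV).
  - by move=> w [/= + qc]; rewrite qc ltnn.
case=> [|c]; last by rewrite !split_eq// !D.
have := D 0%N; rewrite (_ : mkset _ = [set w | quant N (U w) = 0%N]).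
  rewrite (_ : mkset (fun w => is_true (quant _ _ <= _)%N) = [set w | quant N
    (U' w) = 0%N])//.
  by apply/seteqP; split=> w /=; rewrite leqn0 => /eqP.
by apply/seteqP; split=> w /=; rewrite leqn0 => /eqP.
Qed.

End quant.

Section independent_coordinates.
Context {R : realType}.

Lemma indep_subfamily (d : measure_display) (Om : measurableType d)
    (P : probability Om R) (I : finType) (X : I -> Om -> R) (k : nat)
    (e : 'I_k -> I) :
  mutually_independent P X -> injective e ->
  (forall i, measurable_fun setT (X i)) ->
  forall B : 'I_k -> set R, (forall j, measurable (B j)) ->
  pr P [set w | forall j, B j (X (e j) w)] =
  \prod_j pr P (X (e j) @^-1` B j).
Proof.
move=> indX ei mX B mB; apply: EFin_inj.
have mXB i C : measurable C -> measurable (X i @^-1` C).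
  by move=> mC; rewrite -[_ @^-1` _]setTI; exact: mX.
rewrite prE; last first.
  by apply: (@measurable_forall _ Om _ (fun j => X (e j) @^-1` B j)) => j;
    exact: mXB.
pose B' i := if [pick j | e j == i] is Some j then B j else setT.
have B'e j : B' (e j) = B j.
  by rewrite /B'; case: pickP => [l /eqP/ei ->//|/(_ j)]; rewrite eqxx.
have mB' i : measurable (B' i) by rewrite /B'; case: pickP.
have := indX [set e j | j : 'I_k]%SET B' mB'.
rewrite big_imset /=; last by move=> a b _ _; exact: ei.
rewrite (_ : \bigcap_(i in _) _ = [set w | forall j, B j (X (e j) w)]).
  move=> ->; rewrite -prodEFin; apply: eq_bigr => j _.
  by rewrite B'e prE//; exact: mXB.
apply/seteqP; split=> w H.
  by move=> j; rewrite -B'e; apply: H => /=; apply/imsetP; exists j.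
by move=> i /= /imsetP[j _ ->]; rewrite /preimage/= B'e; exact: H.
Qed.

(** The mean of a function of the grid point is a finite sum of products of
    one-dimensional probabilities. *)
Lemma expectation_grid (d d' : measure_display) (Om : measurableType d)
    (Om' : measurableType d') (P : probability Om R) (P' : probability Om' R)
    (k N : nat) (V : 'I_k -> Om -> R) (V' : 'I_k -> Om' -> R)
    (h : ('I_k -> nat) -> R) (M : R) :
  (forall j, measurable_fun setT (V j)) ->
  (forall j, measurable_fun setT (V' j)) ->
  (forall B : 'I_k -> set R, (forall j, measurable (B j)) ->
    pr P [set w | forall j, B j (V j w)] = \prod_j pr P (V j @^-1` B j)) ->
  (forall B : 'I_k -> set R, (forall j, measurable (B j)) ->
    pr P' [set w | forall j, B j (V' j w)] = \prod_j pr P' (V' j @^-1` B j)) ->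
  (forall j c, pr P [set w | quant N (V j w) = c] =
               pr P' [set w | quant N (V' j w) = c]) ->
  (forall c, `|h c| <= M) ->
  (\int[P]_w h (fun j => quant N (V j w)) =
   \int[P']_w h (fun j => quant N (V' j w)))%R.
Proof.
move=> mV mV' iV iV' VV' hM.
have key (e : measure_display) (O : measurableType e) (Pr : probability O R)
    (W : 'I_k -> O -> R) : (forall j, measurable_fun setT (W j)) ->
    (forall B : 'I_k -> set R, (forall j, measurable (B j)) ->
      pr Pr [set w | forall j, B j (W j w)] = \prod_j pr Pr (W j @^-1` B j)) ->
    (\int[Pr]_w h (fun j => quant N (W j w)) =
     \sum_(c : {ffun 'I_k -> 'I_N.+1})
       h (fun j => c j) * \prod_j pr Pr [set w | quant N (W j w) = c j])%R.
  move=> mW iW.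
  pose g w : {ffun 'I_k -> 'I_N.+1} := [ffun j => inord (quant N (W j w))].
  have gE w c : g w = c <-> forall j, quant N (W j w) = c j.
    split=> [<- j|H]; first by rewrite ffunE inordK// ltnS quant_max.
    by apply/ffunP => j; rewrite ffunE H inord_val.
  have mg c : measurable [set w | g w = c].
    rewrite [X in measurable X](_ : _ =
        [set w | forall j, [set w | quant N (W j w) = c j] w]).
      apply: (@measurable_forall _ O _ (fun j => [set w | quant N (W j w) = c
        j])) => j.
      exact: (measurable_quant N (fun q => q = c j) (mW j)).
    by apply/seteqP; split=> w /= /gE.
  have hE : (fun w => h (fun j => quant N (W j w))) = (fun w => h (fun j => g w
    j)).
    by apply/funext => w; congr h; apply/funext => j; rewrite ffunE inordK//
      ltnS quant_max.
  rewrite hE (@expectation_finite _ _ _ _ _ (enum {ffun 'I_k -> 'I_N.+1}) g (fun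
    c => h (fun j => c j)) M)//.
  - rewrite big_enum; apply: eq_bigr => c _; congr (_ * _).
    rewrite -(iW (fun j => [set y | quant N y = c j])).
      by congr pr; apply/seteqP; split=> w /= /gE.
    move=> j.
    exact: (@measurable_quant _ _ R id N (fun q => q = c j) (@measurable_id _ _
      _)).
  - exact: enum_uniq.
  - rewrite -(pr_setT Pr) (@pr_split _ _ _ _ _ (enum {ffun 'I_k -> 'I_N.+1}) g)
    ?enum_uniq//.
    + by apply: eq_bigr => c _; rewrite setTI.
    + by move=> c _; rewrite setTI.
    + by move=> w _; rewrite mem_enum.
  - exact: (@measurable_fun_fibers _ _ _ _ g (fun c => h (fun j => c j))).
rewrite !key//; apply: eq_bigr => c _; congr (_ * _).
by apply: eq_bigr => j _; rewrite VV'.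
Qed.

End independent_coordinates.

(** * Empirical distribution functions *)

Lemma variance_bound (R : realType) (p N : R) : 0 <= p -> p <= 1 -> 0 <= N ->
  N * N * p ^+ 2 + N * (p - p ^+ 2) - 2 * (N * p) * (N * p) + (N * p) ^+ 2 <= N.
Proof.
move=> p0 p1 N0; have : 0 <= N * (1 - p + p ^+ 2).
  by rewrite mulr_ge0// addr_ge0 ?sqr_ge0 ?subr_ge0.
by move=> ?; lra.
Qed.

Lemma level_lower (R : realType) (a p q q' e h : R) : p <= a + h ->
  `|q' - a| <= e -> q' <= q -> p - q <= e + h.
Proof. by rewrite ler_norml => ? /andP[? ?] ?; lra. Qed.

Lemma level_upper (R : realType) (a p q q' e h : R) : a <= p + h ->
  `|q' - a| <= e -> q <= q' -> q - p <= e + h.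
Proof. by rewrite ler_norml => ? /andP[? ?] ?; lra. Qed.

Section empirical.
Context {R : realType} {d : measure_display} {Om : measurableType d}.
Variables (P : probability Om R) (n : nat) (X : 'I_n.+1 -> {RV P >-> R}).
Variables (mu0 sigma0 mu sigma : R).
Hypotheses (sigma0_gt0 : 0 < sigma0) (sigma_gt0 : 0 < sigma).
Hypothesis sampleX : normal_sample P X mu0 sigma0 mu sigma.
Hypothesis n_gt0 : (0 < n)%N.

Local Notation x := (fun j => X j : Om -> R).
Local Notation F y := (Phi ((y - mu) / sigma)).

Let n0 : 0 < n%:R :> R. Proof. by rewrite ltr0n. Qed.

(** The count is a sum of pairwise independent indicators of probability [p],
    so its variance is [n * (p - p ^ 2)], at most [n]. *)
Lemma chebyshev_count y (eta : R) : 0 < eta ->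
  pr P [set w | eta < `|(count_le X y w)%:R / n%:R - F y|] <=
  (n%:R * eta ^+ 2)^-1.
Proof.
move=> eta0; set p := F y.
pose A (l : 'I_n) := [set w | X (lift ord0 l) w <= y].
have mA l : measurable (A l) by exact: measurable_RV_le.
have pA l : pr P (A l) = p by exact: (pr_Xj_le sigma_gt0 sampleX).
(* The square of the sum [S] of the indicators is the sum of the indicators of
   pairwise intersections, so that both moments are sums of probabilities. *)
pose S w : R := (count_le X y w)%:R.
have SE w : S w = \sum_l 1 * \1_(A l) w.
  rewrite /S /count_le -sum1_card natr_sum big_mkcond; apply: eq_bigr => l _.
  rewrite mul1r indicE inE; case: ifPn => Xl; first by rewrite mem_set.
  by rewrite memNset//; apply/negP.
have S2E w : S w ^+ 2 = \sum_(q : 'I_n * 'I_n) 1 * \1_(A q.1 `&` A q.2) w.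
  rewrite expr2 SE big_distrlr/= pair_big/=; apply: eq_bigr => q _.
  by rewrite !mul1r indicI.
have IS : (\int[P]_w S w = n%:R * p)%R.
  under eq_Rintegral do rewrite SE.
  rewrite (@expectation_simple _ _ _ P _ (index_enum _) (fun=> 1) A) => [|l _];
    last exact: mA.
  under eq_bigr do rewrite pA mul1r.
  by rewrite sumr_const card_ord mulr_natl.
have pAA q : pr P (A q.1 `&` A q.2) = p ^+ 2 + (q.1 == q.2)%:R * (p - p ^+ 2).
  have [->|q12] := eqVneq q.1 q.2.
    by rewrite setIid pA mul1r addrC subrK.
  rewrite mul0r addr0; apply: EFin_inj; rewrite prE; last exact: measurableI.
  have indX : mutually_independent P (fun j => X j : Om -> R) by case: sampleX.
  have := @indep_pair _ _ _ _ _ _ indX (lift ord0 q.1) (lift ord0 q.2)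
    [set` `]-oo, y]] [set` `]-oo, y]].
  rewrite (inj_eq lift_inj) => /(_ q12 (measurable_itv _) (measurable_itv _)).
  have XA l : X (lift ord0 l) @^-1` [set` `]-oo, y]] = A l.
    by apply/seteqP; split=> w; rewrite /preimage/= in_itv.
  by rewrite !XA => ->; rewrite -!prE// !pA expr2 EFinM.
have IS2 : (\int[P]_w (S w ^+ 2) = n%:R * n%:R * p ^+ 2 + n%:R * (p - p ^+
  2))%R.
  under eq_Rintegral do rewrite S2E.
  rewrite (@expectation_simple _ _ _ P _ (index_enum _) (fun=> 1)
    (fun q => A q.1 `&` A q.2)) => [|q _]; last exact: measurableI.
  under eq_bigr do rewrite pAA mul1r.
  rewrite big_split/= sumr_const card_prod card_ord; congr (_ + _).
    by rewrite -(mulr_natl (p ^+ 2)) natrM.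
  rewrite -(pair_big predT predT (fun l l' => (l == l')%:R * (p - p ^+ 2)))/=.
  rewrite (eq_bigr (fun=> p - p ^+ 2)); first by rewrite sumr_const card_ord
    mulr_natl.
  move=> l _; rewrite (bigD1 l)//= eqxx mul1r big1 ?addr0// => l'.
  by rewrite eq_sym => /negbTE ->; rewrite mul0r.
have p0 : 0 <= p := Phi_ge0 _.
have p1 : p <= 1 := Phi_le1 _.
have mS : measurable_fun setT S.
  apply: (@measurable_fun_fibers _ _ _ _ (count_le X y) (fun k => k%:R)) => k.
  exact: measurable_count_le.
have S_le w : `|S w| <= n%:R.
  by rewrite ger0_norm// ler_nat -[X in (_ <= X)%N]card_ord max_card.
have iS : P.-integrable setT (EFin \o S) by exact: bounded_integrable mS S_le.
have iS2 : P.-integrable setT (EFin \o (fun w => S w ^+ 2)).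
  apply: (@bounded_integrable _ _ _ _ _ (n%:R ^+ 2)); first exact:
    measurable_funX.
  by move=> w; rewrite normrX lerXn2r// nnegrE.
pose D w := S w ^+ 2 - 2 * (n%:R * p) * S w + (n%:R * p) ^+ 2.
have DE w : D w = (S w - n%:R * p) ^+ 2.
  by rewrite sqrrB /D mulr_natl mulrnAl (mulrC (S w)).
have icS : P.-integrable setT (EFin \o (fun w => 2 * (n%:R * p) * S w)).
  apply: (@bounded_integrable _ _ _ _ _ (`|2 * (n%:R * p)| * n%:R)).
    exact: measurable_funM.
  by move=> w; rewrite normrM ler_wpM2l.
have ic : P.-integrable setT (EFin \o (fun=> (n%:R * p) ^+ 2 : R)).
  apply: (@bounded_integrable _ _ _ _ _ `|(n%:R * p) ^+ 2|) => [|w].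
    exact: measurable_cst.
  exact: lexx.
have iB : P.-integrable setT (EFin \o (fun w => S w ^+ 2 - 2 * (n%:R * p) * S
  w)).
  apply: (@bounded_integrable _ _ _ _ _ (n%:R ^+ 2 + `|2 * (n%:R * p)| * n%:R)).
    by apply: measurable_funB; [exact: measurable_funX|exact: measurable_funM].
  move=> w; rewrite (le_trans (ler_normB _ _))// lerD//.
    by rewrite normrX lerXn2r// nnegrE.
  by rewrite normrM ler_wpM2l.
have iD : P.-integrable setT (EFin \o D).
  apply: (@bounded_integrable _ _ _ _ _ (n%:R ^+ 2 + `|2 * (n%:R * p)| * n%:R +
    `|(n%:R * p) ^+ 2|)).
    apply: measurable_funD => //.
    by apply: measurable_funB; [exact: measurable_funX|exact: measurable_funM].
  move=> w; rewrite (le_trans (ler_normD _ _))// lerD//.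
  rewrite (le_trans (ler_normB _ _))// lerD//.
    by rewrite normrX lerXn2r// nnegrE.
  by rewrite normrM ler_wpM2l.
have ID : (\int[P]_w D w <= n%:R)%R.
  rewrite RintegralD// RintegralB// RintegralZl// Rintegral_cst// IS2 IS.
  rewrite [fine _](pr_setT P) mulr1; exact: variance_bound (ltW n0).
pose B := [set w | eta < `|(count_le X y w)%:R / n%:R - p|].
have mB : measurable B.
  have := @measurable_fibers _ Om nat (count_le X y)
    [set k | eta < `|k%:R / n%:R - p|] (fun k => measurable_count_le _ _ _).
  by [].
have neta : 0 < (n%:R * eta) ^+ 2 by rewrite exprn_gt0// mulr_gt0.
have H : (\int[P]_w ((n%:R * eta) ^+ 2 * \1_B w) <= \int[P]_w D w)%R.
  apply: le_Rintegral => //.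
    apply: (@bounded_integrable _ _ _ _ _ ((n%:R * eta) ^+ 2)).
      by apply: measurable_funM => //; exact: measurable_indic.
    move=> w; rewrite normrM gtr0_norm// ler_piMr ?(ltW neta)// indicE.
    by case: (_ \in _); rewrite ?normr1 ?normr0.
  move=> w _; rewrite indicE; have [Bw|Bw] := pselect (B w); last first.
    by rewrite memNset// mulr0 DE sqr_ge0.
  rewrite mem_set// mulr1 DE -[leRHS]real_normK ?num_real//.
  apply: lerXn2r; rewrite ?nnegrE//; first by rewrite mulr_ge0 ?(ltW eta0).
  have -> : S w - n%:R * p = n%:R * ((count_le X y w)%:R / n%:R - p).
    by rewrite mulrBr mulrCA divff ?mulr1// gt_eqF.
  by rewrite normrM gtr0_norm// ler_pM2l// ltW.
move: H; rewrite RintegralZl//; last first.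
  apply: (@bounded_integrable _ _ _ _ _ 1); first exact: measurable_indic.
  by move=> w; rewrite indicE; case: (_ \in _); rewrite ?normr1 ?normr0.
rewrite Rintegral_indic// => /le_trans/(_ ID).
rewrite mulrC -ler_pdivlMr// => /le_trans; apply.
by rewrite exprMn expr2 -mulrA invfM mulrA divff ?mul1r// gt_eqF.
Qed.

Lemma quantile u : 0 < u < 1 -> exists y, F y = u.
Proof.
move=> /Phi_surj[z zu]; exists (mu + z * sigma).
by rewrite addrAC subrr add0r mulfK ?gt_eqF.
Qed.

Lemma F_lt_inv y z : F y < F z -> y < z.
Proof.
apply: contraTT; rewrite -!leNgt => zy; apply: Phi_nondecreasing.
by rewrite ler_pM2r ?invr_gt0// lerB.
Qed.

Lemma count_le_nondecreasing y z w : y <= z ->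
  (count_le X y w)%:R / n%:R <= (count_le X z w)%:R / n%:R :> R.
Proof.
move=> yz; rewrite ler_pM2r ?invr_gt0// ler_nat; apply: subset_leq_card.
by apply/fintype.subsetP => l; rewrite !inE => /le_trans; apply.
Qed.

Lemma count_le_max y w : (count_le X y w)%:R / n%:R <= 1 :> R.
Proof.
by rewrite ler_pdivrMr// mul1r ler_nat -[X in (_ <= X)%N]card_ord max_card.
Qed.

(** Both distribution functions being monotone, closeness at the quantiles of
    orders [k / K] forces closeness everywhere up to [1 / K]. *)
Lemma glivenko_cantelli K (eta : R) : (0 < K)%N -> 0 < eta ->
  exists B, [/\ measurable B, pr P B <= K%:R * (n%:R * eta ^+ 2)^-1 &
    forall w, ~ B w -> forall y,
      `|(count_le X y w)%:R / n%:R - F y| <= eta + K%:R^-1].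
Proof.
move=> K0 eta0; have K0' : 0 < K%:R :> R by rewrite ltr0n.
have /choice[c Hc] : forall k : 'I_K, exists y, (0 < k)%N -> F y = k%:R / K%:R.
  move=> k; have [k0|//] := boolP (0 < k)%N; last by exists 0.
  have [|y Fy] := @quantile (k%:R / K%:R).
    by rewrite divr_gt0 ?ltr0n//= ltr_pdivrMr// mul1r ltr_nat.
  by exists y.
pose B (k : 'I_K) := [set w | eta < `|(count_le X (c k) w)%:R / n%:R - F (c
  k)|].
have mB k : measurable (B k).
  exact: (@measurable_fibers _ Om nat (count_le X (c k))
    [set q | eta < `|q%:R / n%:R - F (c k)|] (fun q => measurable_count_le _ _
      _)).
exists [set w | exists k, B k w]; split.
- exact: measurable_exists.
- rewrite (le_trans (pr_exists_le P mB))//.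
  rewrite (@le_trans _ _ (\sum_(k < K) (n%:R * eta ^+ 2)^-1))//.
    by apply: ler_sum => k _; exact: chebyshev_count.
  by rewrite sumr_const card_ord [leRHS]mulr_natl.
move=> w nB y.
have near_c (k : 'I_K) : (0 < k)%N ->
    `|(count_le X (c k) w)%:R / n%:R - k%:R / K%:R| <= eta.
  move=> k0; rewrite -(Hc _ k0) leNgt; apply/negP => Bk.
  by apply: nB; exists k.
have emp0 : 0 <= (count_le X y w)%:R / n%:R :> R by rewrite divr_ge0.
have K1 : 0 <= K%:R^-1 :> R by rewrite invr_ge0 ltW.
have iK k : k.+1%:R / K%:R = k%:R / K%:R + K%:R^-1 :> R.
  by rewrite -natr1 mulrDl mul1r.
have eK : K%:R^-1 <= eta + K%:R^-1 by rewrite lerDr ltW.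
rewrite ler_norml lerNl opprB; apply/andP; split.
  have := quant_ge K0 (Phi_le1 ((y - mu) / sigma)); have := @quant_gt _ K ^~ (F
    y).
  have := quant_max K (F y).
  case: (quant K (F y)) => [|[|k]] qK gt; rewrite ?mul0r ?iK => up.
  - by rewrite (le_trans _ eK)// (le_trans _ K1)// subr_le0 (le_trans up).
  - rewrite (le_trans _ eK)// lerBlDr (le_trans up)//.
    by rewrite mul0r add0r lerDl.
  - have kK : (k.+1 < K)%N := qK.
    rewrite -iK in up.
    apply: level_lower (near_c (Ordinal kK) isT) _ => /=; first exact: up.
    apply/count_le_nondecreasing/ltW/F_lt_inv; rewrite Hc//=.
    exact: gt.
(* The upper bound uses the grid point next above [F y], found by rounding
   [1 - F y] up. *)
have F1 : 1 - F y <= 1 by rewrite lerBlDr lerDl Phi_ge0.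
have := quant_ge K0 F1; have := @quant_gt _ K ^~ (1 - F y).
have := quant_max K (1 - F y).
have e1 := count_le_max y w.
case: (quant K (1 - F y)) => [|[|k]] qK gt.
- rewrite mul0r subr_le0 => up; rewrite (le_trans _ eK)// (le_trans _ K1)//.
  by rewrite subr_le0 (le_trans e1).
- rewrite iK mul0r add0r => up; rewrite (le_trans _ eK)// lerBlDr (le_trans
  e1)//.
  by rewrite -lerBlDr.
- have kK : (K - k.+1 < K)%N by rewrite ltn_subrL K0.
  have kK0 : (0 < K - k.+1)%N by rewrite subn_gt0.
  have kE : (K - k.+1)%:R / K%:R = 1 - k.+1%:R / K%:R :> R.
    by rewrite natrB ?(ltnW qK)// mulrBl divff// gt_eqF.
  move=> up; apply: level_upper (near_c (Ordinal kK) kK0) _ => /=.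
    rewrite kE lerBlDr -addrA -[K%:R^-1 + _]addrC -iK.
    by rewrite -lerBlDl.
  apply/count_le_nondecreasing/ltW/F_lt_inv; rewrite Hc//= kE.
  by rewrite ltrBrDl -ltrBrDr; exact: gt.
Qed.

Lemma rank_count j w :
  rank x j w = ((X ord0 w <= X j w)%R + count_le X (X j w) w)%N.
Proof.
rewrite /rank; transitivity (\sum_(l < n.+1) (X l w <= X j w)%R)%N => //.
rewrite big_ord_recl; congr addn.
rewrite /count_le -sum1_card [RHS]big_mkcond; apply: eq_bigr => l _.
by rewrite inE; case: (_ <= _).
Qed.

(** The rank of [X j] counts [X ord0] besides the variables counted by
    [count_le], which changes [rank x j w - 1] by at most one. *)
Lemma rank_near_F K (eta : R) j w :
  (forall y, `|(count_le X y w)%:R / n%:R - F y| <= eta + K%:R^-1) ->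
  `|n%:R^-1 * ((rank x j w)%:R - 1) - F (X j w)| <= eta + K%:R^-1 + n%:R^-1.
Proof.
move=> H; have Hj := H (X j w).
rewrite -(subrKA ((count_le X (X j w) w)%:R / n%:R)) (le_trans (ler_normD _
  _))//.
rewrite addrC lerD// mulrC -mulrBl normrM [ `|n%:R^-1|]gtr0_norm ?invr_gt0//.
rewrite ler_piMl ?invr_ge0 ?(ltW n0)//.
rewrite rank_count natrD; case: (X ord0 w <= X j w).
  by rewrite addrAC addrK subrr normr0.
by rewrite addrAC addrK sub0r normrN normr1.
Qed.

Lemma rescaled_rank_itv j w : (0 : R) <= n%:R^-1 * ((rank x j w)%:R - 1) <= (1 :
  R).
Proof.
rewrite mulr_ge0 ?invr_ge0 ?(ltW n0)//=; last first.
  by rewrite subr_ge0 ler1n rank_gt0.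
rewrite mulrC ler_pdivrMr// mul1r lerBlDr natr1 ler_nat.
exact: rank_le.
Qed.

Lemma measurable_level j : measurable_fun setT (fun w => F (X j w)).
Proof.
apply: (@measurableT_comp _ _ _ _ _ _ (@Phi R)).
  by apply: continuous_measurable_fun; exact: Phi_continuous.
by apply: measurable_funM => //; apply: measurable_funB.
Qed.

(** Glivenko-Cantelli makes every rescaled rank [r]-close to its level off an
    event of probability [O (1 / n)]. *)
Lemma large_sample_near (m : nat) (e : 'I_m.+1 -> 'I_n.+1)
    (f : 'rV[R]_m.+1 -> R) (M eps r eta : R) (K : nat) :
  continuous f -> (forall u, `|f u| <= M) -> 0 <= eps ->
  (forall u v : 'rV[R]_m.+1, (forall j, 0 <= u ord0 j <= 1) ->
     (forall j, `|u ord0 j - v ord0 j| < r) -> `|f u - f v| <= eps) ->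
  (0 < K)%N -> 0 < eta -> eta + K%:R^-1 + n%:R^-1 < r ->
  `|\int[P]_w f (\row_j (n%:R^-1 * ((rank x (e j) w)%:R - 1)))
    - \int[P]_w f (\row_j F (X (e j) w))| <=
  eps + 2 * M * (K%:R * (n%:R * eta ^+ 2)^-1).
Proof.
move=> fc fM eps0 fr K0 eta0 etar.
have [B [mB prB HB]] := glivenko_cantelli K0 eta0.
have M0 : 0 <= M := le_trans (normr_ge0 _) (fM 0).
have mrk j : measurable_fun setT (fun w => n%:R^-1 * ((rank x (e j) w)%:R - 1) :
  R).
  apply: (@measurable_fun_fibers _ _ _ _ (rank x (e j)) (fun q => n%:R^-1 *
    (q%:R - 1))) => q.
  rewrite (_ : mkset _ = [set w | [ffun i => rank x i w] (e j) = q]).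
    exact: (@measurable_ranks _ _ Om n x (fun r => r (e j) = q)).
  by apply/funext => w; rewrite /mkset ffunE.
apply: (@le_trans _ _ (eps + 2 * M * pr P B)); last first.
  by rewrite lerD2l ler_wpM2l// mulr_ge0.
apply: expectation_near => //.
- exact: (measurable_fun_continuous_row (V := fun j w => n%:R^-1 * ((rank x (e
  j) w)%:R - 1)) fc).
- apply: (measurable_fun_continuous_row (V := fun j w => F (X (e j) w)) fc) =>
  j.
  exact: measurable_level.
- move=> w nB; apply: fr => j; rewrite !mxE; first exact: rescaled_rank_itv.
  by apply: le_lt_trans etar; apply: rank_near_F; exact: HB.
Qed.

End empirical.

(** * Convergence for large samples *)

Section laws.
Context {R : realType} {d : measure_display} {Om : measurableType d}.
Variable P : probability Om R.

Lemma pr_standardized_le (Y : {RV P >-> R}) (a b m s z : R) : 0 < b -> 0 < s ->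
  has_law P Y (normal_prob a b) ->
  pr P [set w | (Y w - m) / s <= z] = Phi (z * (s / b) + (m - a) / b).
Proof.
move=> b0 s0 HY; apply: EFin_inj.
have -> : z * (s / b) + (m - a) / b = (m + z * s - a) / b.
  by rewrite mulrA -mulrDl addrA [z * s + m]addrC.
rewrite -normal_prob_halfline// -(HY `]-oo, m + z * s]%classic)// prE.
  congr (P _); apply/seteqP; split=> w; rewrite /preimage /= in_itv/=.
    by rewrite ler_pdivrMr// lerBlDl.
  by rewrite ler_pdivrMr// lerBlDl.
apply: measurable_set_le => //.
by apply: measurable_funM => //; exact: measurable_funB.
Qed.

Lemma level_uniform (Y : {RV P >-> R}) (a b u : R) : 0 < b ->
  has_law P Y (normal_prob a b) -> 0 <= u < 1 ->
  pr P [set w | Phi ((Y w - a) / b) <= u] = u.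
Proof.
move=> b0 HY /andP[u0 u1]; have [->|un0] := eqVneq u 0.
  rewrite (_ : mkset _ = set0) ?pr_set0// -subset0 => w.
  by rewrite /= leNgt Phi_gt0.
have [|z <-] := @Phi_surj R u; first by rewrite lt_def un0 u0.
rewrite (_ : mkset _ = [set w | (Y w - a) / b <= z]).
  by rewrite (pr_standardized_le _ _ b0 b0 HY) divff ?gt_eqF// mulr1 subrr mul0r
    addr0.
by apply/funext => w; rewrite /mkset Phi_increasing.
Qed.

Lemma uniform_le (Y : {RV P >-> R}) (u : R) : has_law P Y (uniform_prob (@ltr01
  R)) ->
  0 <= u < 1 -> pr P [set w | Y w <= u] = u.
Proof.
move=> HY /andP[u0 u1]; apply: EFin_inj; rewrite prE; last first.
  by apply: measurable_set_le => //; exact: measurable_cst.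
have -> : [set w | Y w <= u] = Y @^-1` [set` `]-oo, u]].
  by apply/seteqP; split=> w; rewrite /preimage /= in_itv.
rewrite [LHS](HY `]-oo, u]%classic)// /uniform_prob integral_uniform_pdf.
have -> : [set` `]-oo, u]] `&` [set` `[0 : R, 1]] = [set` `[0, u]].
  apply/seteqP; split=> y; rewrite /= !in_itv/=; first by move=> [-> /andP[->]].
  by move=> /andP[-> yu]; rewrite yu (le_trans yu)// ltW.
rewrite (eq_integral (fun=> 1%E)).
  by rewrite integral_cst//= mul1e lebesgue_measure_itv/= lte_fin;
    case: ltP => [_|]; rewrite ?sube0// => ule; congr EFin; apply/le_anti/andP.
move=> y; rewrite inE/= in_itv/= => /andP[y0 yu].
by rewrite /uniform_pdf y0 (le_trans yu (ltW u1)) subr0 invr1.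
Qed.

Lemma uniform_outside (Y : {RV P >-> R}) : has_law P Y (uniform_prob (@ltr01 R))
  ->
  pr P [set w | ~ (0 <= Y w <= 1)] = 0.
Proof.
move=> HY; rewrite /pr.
have -> : [set w | ~ (0 <= Y w <= 1)] = Y @^-1` (~` [set` `[0 : R, 1]]).
  by apply/seteqP; split=> w; rewrite /preimage /= in_itv.
rewrite [P _](HY (~` [set` `[0 : R, 1]]))//; last exact: measurableC.
by rewrite /uniform_prob integral_uniform_pdf setICl integral_set0.
Qed.

Lemma quantize_near (k N : nat) (W : 'I_k.+1 -> Om -> R) (f : 'rV[R]_k.+1 -> R)
    (M eps r : R) (B : set Om) :
  continuous f -> (forall u, `|f u| <= M) -> 0 <= eps ->
  (forall u v : 'rV[R]_k.+1, (forall j, 0 <= u ord0 j <= 1) ->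
     (forall j, `|u ord0 j - v ord0 j| < r) -> `|f u - f v| <= eps) ->
  (0 < N)%N -> N%:R^-1 < r -> (forall j, measurable_fun setT (W j)) ->
  measurable B -> (forall w, ~ B w -> forall j, 0 <= W j w <= 1) ->
  `|\int[P]_w f (\row_j W j w)
    - \int[P]_w f (\row_j ((quant N (W j w))%:R / N%:R))| <=
  eps + 2 * M * pr P B.
Proof.
move=> fc fM eps0 fr N0 Nr mW mB HB; apply: expectation_near => //.
- exact: measurable_fun_continuous_row.
- apply: (measurable_fun_continuous_row (V := fun j w => (quant N (W j w))%:R /
  N%:R) fc) => j.
  apply: (@measurable_fun_fibers _ _ _ _ (fun w => quant N (W j w)) (fun q =>
    q%:R / N%:R)) => q.
  exact: (measurable_quant N (fun c => c = q) (mW j)).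
- move=> w nB; apply: fr => j; rewrite !mxE; first exact: HB.
  by apply: le_lt_trans Nr; apply: quant_dist => //; exact: HB.
Qed.

End laws.

Lemma three_thirds (R : realType) (r a b : R) : a < r / 3 -> b < r / 3 ->
  r / 3 + a + b < r.
Proof. by move=> ? ?; lra. Qed.

Lemma tail_bound (R : realType) (a b q nt e : R) : 0 < q -> 0 < nt -> 0 < e ->
  a * b / q / e <= nt -> a * (b * (nt * q)^-1) <= e.
Proof.
move=> q0 nt0 e0; rewrite ler_pdivrMr// => H.
have -> : a * (b * (nt * q)^-1) = a * b / q / nt by field; rewrite !gt_eqF.
by rewrite ler_pdivrMr// [leRHS]mulrC.
Qed.

Lemma four_quarters (R : realType) (a b c l e s : R) :
  `|a - b| <= e / 4 + s -> s <= e / 4 -> `|b - c| <= e / 4 ->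
  `|l - c| <= e / 4 -> `|l - a| <= e.
Proof.
by rewrite !ler_norml => /andP[? ?] ? /andP[? ?] /andP[? ?]; lra.
Qed.

Lemma unlift_inj m (h : 'I_m.+1) : injective (unlift h).
Proof.
move=> j k; case: unliftP => [j' ->|->]; case: unliftP => [k' ->|->] //.
by move=> [->].
Qed.

Unset Implicit Arguments.

Section large_samples.
Context {R : realType} {T : Type} {F : set_system T} {FF : ProperFilter F}.
Variables (m : nat) (n : T -> nat) (mu0 sigma0 mu sigma : T -> R).
Context {d : T -> measure_display} {Om : forall t, measurableType (d t)}.
Variables (P : forall t, probability (Om t) R)
  (X : forall t, 'I_(n t).+1 -> {RV (P t) >-> R})
  (i : forall t, 'I_m -> 'I_(n t).+1).
Hypotheses (sigma0_gt0 : forall t, 0 < sigma0 t)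
  (sigma_gt0 : forall t, 0 < sigma t) (n_gt0 : forall t, (0 < n t)%N).
Hypothesis sampleX : forall t,
  normal_sample (P t) (X t) (mu0 t) (sigma0 t) (mu t) (sigma t).
Hypotheses (i_inj : forall t, injective (i t))
  (i_neq0 : forall t k, i t k != ord0).

Variables (mu0' sigma0' mu' sigma' : R).
Context {d' : measure_display} {Om' : measurableType d'}.
Variables (P' : probability Om' R) (X0' : {RV P' >-> R})
  (Y : 'I_m -> {RV P' >-> R}).
Hypotheses (sigma0'_gt0 : 0 < sigma0') (sigma'_gt0 : 0 < sigma').
Hypothesis same_rho : forall t, sigma t / sigma0 t = sigma' / sigma0'.
Hypothesis same_delta : forall t,
  (mu t - mu0 t) / sigma0 t = (mu' - mu0') / sigma0'.
Hypothesis n_infty : n @ F --> \oo.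
Hypothesis lawX0' : has_law P' X0' (normal_prob mu0' sigma0').
Hypothesis lawY : forall k, has_law P' (Y k) (uniform_prob (@ltr01 R)).

Let Z w := Phi ((X0' w - mu') / sigma').
Let ZY (k : option 'I_m) : Om' -> R := if k is Some l then Y l : Om' -> R else
  Z.

Hypothesis indep_ZY : mutually_independent P' ZY.

Local Notation x t := (fun j => X t j : Om t -> R).

Let e t (j : 'I_m.+1) : 'I_(n t).+1 :=
  if unlift ord0 j is Some l then i t l else ord0.

Let e_inj t : injective (e t).
Proof.
move=> j k; rewrite /e; case: unliftP => [j' ->|->]; case: unliftP => [k' ->|->]
  //.
- by move=> /i_inj ->.
- by move=> /eqP; rewrite (negbTE (i_neq0 _ _)).
- by move=> /esym/eqP; rewrite (negbTE (i_neq0 _ _)).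
Qed.

Let V t (j : 'I_m.+1) w := Phi ((X t (e t j) w - mu t) / sigma t).
Let W (j : 'I_m.+1) : Om' -> R := ZY (unlift ord0 j).

Let mPhi : measurable_fun setT (@Phi R).
Proof. by apply: continuous_measurable_fun; exact: Phi_continuous. Qed.

Let mZY k : measurable_fun setT (ZY k).
Proof.
case: k => [l|] //=; apply: (@measurableT_comp _ _ _ _ _ _ (@Phi R)) => //.
by apply: measurable_funM => //; exact: measurable_funB.
Qed.

Let mV t j : measurable_fun setT (V t j).
Proof. exact: measurable_level. Qed.

Let mW j : measurable_fun setT (W j). Proof. exact: mZY. Qed.

Let boxV t (B : 'I_m.+1 -> set R) : (forall j, measurable (B j)) ->
  pr (P t) [set w | forall j, B j (V t j w)] =
  \prod_j pr (P t) (V t j @^-1` B j).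
Proof.
move=> mB.
have indX : mutually_independent (P t) (fun j => X t j : Om t -> R).
  by case: (sampleX t).
pose G (y : R) := Phi ((y - mu t) / sigma t).
have mG : measurable_fun setT G.
  apply: (@measurableT_comp _ _ _ _ _ _ (@Phi R)) => //.
  by apply: measurable_funM => //; exact: measurable_funB.
apply: (indep_subfamily indX (@e_inj t) _ (B := fun j => G @^-1` B j)) => j //.
by rewrite -[_ @^-1` _]setTI; exact: mG.
Qed.

Let boxW (B : 'I_m.+1 -> set R) : (forall j, measurable (B j)) ->
  pr P' [set w | forall j, B j (W j w)] = \prod_j pr P' (W j @^-1` B j).
Proof.
move=> mB; apply: (indep_subfamily indep_ZY) => //; exact: unlift_inj.
Qed.

(** The levels [V] have exactly the limiting law, for every sample size. *)
Let sameVW t j u : 0 <= u < 1 ->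
  pr (P t) [set w | V t j w <= u] = pr P' [set w | W j w <= u].
Proof.
move=> u01; case: (sampleX t) => _ law0 law1.
rewrite /V /W /e; case: unliftP => [l _|_] /=.
  by rewrite (level_uniform (sigma_gt0 t) (law1 _ (i_neq0 t l)) u01) uniform_le.
have [Fu|[z Fz]] := Phi_sublevel u01.
  rewrite (_ : mkset _ = set0) ?pr_set0; last first.
    by rewrite -subset0 => w; rewrite /= Fu.
  by rewrite (_ : mkset _ = set0) ?pr_set0// -subset0 => w; rewrite /= /Z Fu.
rewrite (_ : mkset _ = [set w | (X t ord0 w - mu t) / sigma t <= z]); last
  first.
  by apply/funext => w; rewrite /mkset Fz.
rewrite (_ : [set w | Z w <= u] = [set w | (X0' w - mu') / sigma' <= z]); last
  first.
  by apply/funext => w; rewrite /mkset /Z Fz.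
rewrite (pr_standardized_le _ _ (sigma0_gt0 t) (sigma_gt0 t) law0).
by rewrite (pr_standardized_le _ _ sigma0'_gt0 sigma'_gt0 lawX0') same_rho
  same_delta.
Qed.

(** The ranks are replaced by the levels [V], the levels are rounded to a grid,
    rounded levels have the law of the rounded limit, and rounding is undone;
    each replacement costs [eps / 4], and so does the exceptional event of
    [large_sample_near]. *)
Lemma cvg_rescaled_ranks :
  cvg_in_distribution F P
    (fun t w => (n t)%:R^-1 *: (cons_rV (rank (x t) ord0 w)%:R
       (fun k => (rank (x t) (i t k) w)%:R) - const_mx 1)) P'
    (fun w => cons_rV (Z w) (fun k => Y k w)).
Proof.
move=> f fc [M fM].
have M0 : 0 <= M := le_trans (normr_ge0 _) (fM 0).
pose A t w : 'rV[R]_m.+1 :=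
  \row_j ((n t)%:R^-1 * ((rank (x t) (e t j) w)%:R - 1)).
have mrk t j : measurable_fun setT
    (fun w => (n t)%:R^-1 * ((rank (x t) (e t j) w)%:R - 1) : R).
  apply: (@measurable_fun_fibers _ _ _ _ (rank (x t) (e t j)) (fun q => (n
    t)%:R^-1 * (q%:R - 1))) => q.
  rewrite (_ : mkset _ = [set w | [ffun i => rank (x t) i w] (e t j) = q]).
    exact: (@measurable_ranks _ _ (Om t) (n t) (x t) (fun r => r (e t j) = q)).
  by apply/funext => w; rewrite /mkset ffunE.
pose S t w : 'rV[R]_m.+1 := (n t)%:R^-1 *: (cons_rV (rank (x t) ord0 w)%:R
  (fun k => (rank (x t) (i t k) w)%:R) - const_mx 1).
have EA t : 'E_(P t)[f \o S t]%E = (\int[P t]_w f (A t w))%R%:E.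
  rewrite -(@expectation_bounded _ _ _ _ (fun w => f (A t w)) M)//.
    congr expectation; apply/funext => w /=; congr f; apply/rowP => j.
    by rewrite !mxE /e; case: unliftP.
  exact: (measurable_fun_continuous_row fc (mrk t)).
have EW : 'E_P'[f \o (fun w => cons_rV (Z w) (fun k => Y k w))]%E =
    (\int[P']_w f (\row_j W j w))%R%:E.
  rewrite -(@expectation_bounded _ _ _ _ (fun w => f (\row_j W j w)) M)//.
    congr expectation; apply/funext => w /=; congr f; apply/rowP => j.
    by rewrite !mxE /W; case: unliftP.
  exact: (measurable_fun_continuous_row fc mW).
rewrite (funext EA) EW; apply: cvg_EFin; first by near=> t.
apply/cvgrPdist_le => eps eps0.
have e4 : 0 < eps / 4 by rewrite divr_gt0.
have [r r0 fr] := cube_uniform_continuity fc e4.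
have r3 : 0 < r / 3 by rewrite divr_gt0.
have [N N0 Nr] : exists2 N, (0 < N)%N & N%:R^-1 < r / 3.
  near \oo%classic => N; exists N.+1 => //; near: N.
  exact: (near_infty_natSinv_lt (PosNum r3)).
have Nr' : N%:R^-1 < r by rewrite (lt_trans Nr)// gtr_pMr// invf_lt1// ltr1n.
pose B := [set w | exists l, [set w | ~ (0 <= Y l w <= 1)] w].
have mB1 l : measurable [set w | ~ (0 <= Y l w <= 1)].
  rewrite (_ : mkset _ = ~` (Y l @^-1` [set` `[0, 1]])).
    by apply: measurableC; exact: measurable_funPTI.
  by apply/seteqP; split=> w; rewrite /= /preimage /= in_itv.
have mB : measurable B by exact: measurable_exists.
have B0 : pr P' B = 0.
  apply: le_anti; rewrite pr_ge0 andbT (le_trans (pr_exists_le P' mB1))//.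
  by rewrite big1// => l _; exact: uniform_outside.
have HB w : ~ B w -> forall j, 0 <= W j w <= 1.
  move=> nB j; rewrite /W; case: unliftP => [l _|_] /=.
    by apply: contrapT => Yl; apply: nB; exists l.
  by rewrite Phi_ge0 Phi_le1.
have QW := quantize_near P' fc fM (ltW e4) fr N0 Nr' mW mB HB.
rewrite B0 mulr0 addr0 in QW.
have VW t : (\int[P t]_w f (\row_j ((quant N (V t j w))%:R / N%:R)) =
    \int[P']_w f (\row_j ((quant N (W j w))%:R / N%:R)))%R.
  apply: (@expectation_grid _ _ _ _ _ (P t) P' _ N (V t) W
    (fun c => f (\row_j ((c j)%:R / N%:R))) M) => //.
    exact: boxV.
  move=> j c.
  apply: (@quant_same_law _ _ _ _ _ (P t) P' (V t j) (W j) N (mV t j) (mW j)) =>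
    u.
  exact: sameVW.
have V01 t w : ~ set0 w -> forall j, 0 <= V t j w <= 1.
  by move=> _ j; rewrite Phi_ge0 Phi_le1.
have QV t := quantize_near (P t) fc fM (ltW e4) fr N0 Nr' (mV t) measurable0
  (V01 t).
have n_infty' : ((n t)%:R : R) @[t --> F] --> +oo by exact/cvgrnyP.
near=> t.
have nt0 : 0 < (n t)%:R :> R by rewrite ltr0n.
have nr : (n t)%:R^-1 < r / 3.
  rewrite invf_plt ?posrE//; near: t.
  by move/cvgryPgt : n_infty'; exact.
have tail : 2 * M * (N%:R * ((n t)%:R * (r / 3) ^+ 2)^-1) <= eps / 4.
  apply: tail_bound => //; first by rewrite exprn_gt0.
  by near: t; move/cvgryPge : n_infty'; exact.
have r3r : r / 3 + N%:R^-1 + (n t)%:R^-1 < r by exact: three_thirds.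
have LA := large_sample_near (sigma_gt0 t) (sampleX t) (n_gt0 t)
  (e t) fc fM (ltW e4) fr N0 r3 r3r.
have {QV} := QV t; rewrite pr_set0 mulr0 addr0 VW => QV.
exact: four_quarters LA tail QV QW.
Unshelve. all: end_near. Qed.

End large_samples.

Set Implicit Arguments.

(** * Levels near the mean of the outlying variable *)

Section level_limits.
Context {R : realType} {T : Type} {F : set_system T} {FF : ProperFilter F}.
Implicit Types delta rho : T -> R.

Lemma cvg_level_delta_ninfty delta rho (rho0 K : R) : 0 < rho0 ->
  (forall t, rho t = rho0) -> delta @ F --> -oo ->
  Phi ((K - delta t) / rho t) @[t --> F] --> (1 : R).
Proof.
move=> r0 rhoE dl.
have H : (K - delta t) / rho t @[t --> F] --> +oo.
  apply/cvgryPge => A; near=> t; rewrite rhoE ler_pdivlMr// lerBrDr addrC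
    -lerBrDr.
  by near: t; move/cvgrNyPle : dl; exact.
exact: (cvg_comp _ _ H (@Phi_cvg_pinfty R)).
Unshelve. all: end_near. Qed.

Lemma cvg_level_delta_pinfty delta rho (rho0 K : R) : 0 < rho0 ->
  (forall t, rho t = rho0) -> delta @ F --> +oo ->
  Phi ((K - delta t) / rho t) @[t --> F] --> (0 : R).
Proof.
move=> r0 rhoE dl.
have H : (K - delta t) / rho t @[t --> F] --> -oo.
  apply/cvgrNyPle => A; near=> t; rewrite rhoE ler_pdivrMr// lerBlDr addrC
    -lerBlDr.
  by near: t; move/cvgryPge : dl; exact.
exact: (cvg_comp _ _ H (@Phi_cvg_ninfty R)).
Unshelve. all: end_near. Qed.

Lemma cvg_level_rho_pinfty delta rho (r K : R) : (forall t, 0 < rho t) ->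
  rho @ F --> +oo -> (delta t / rho t) @[t --> F] --> r ->
  Phi ((K - delta t) / rho t) @[t --> F] --> Phi (- r).
Proof.
move=> rho_gt0 rl dr.
have V0 : (rho t)^-1 @[t --> F] --> (0 : R).
  by apply/gtr0_cvgV0 => //; near=> t; exact: rho_gt0.
have H : (K - delta t) / rho t @[t --> F] --> - r.
  rewrite (_ : (fun t => _) = (fun t => K * (rho t)^-1 - delta t / rho t)); last
    first.
    by apply/funext => t; rewrite mulrBl.
  rewrite -[- r]add0r -[0](mulr0 K); apply: cvgB => //.
  by apply: cvgM => //; exact: cvg_cst.
exact: (cvg_comp _ _ H (@Phi_continuous R _)).
Unshelve. all: end_near. Qed.

End level_limits.

Lemma binpmf1 (R : realType) n v : (1 <= v <= n.+1)%N ->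
  binpmf n (1 : R) v.-1 = (v == n.+1)%:R.
Proof.
case: v => [|v] //=; rewrite ltnS eqSS /binpmf subrr expr1n mulr1 => vn.
rewrite expr0n subn_eq0; have [->|nv] := eqVneq v n.
  by rewrite binn leqnn mulr1.
by rewrite leqNgt ltn_neqAle nv vn mulr0.
Qed.

Lemma binpmf0 (R : realType) n v : (1 <= v)%N ->
  binpmf n (0 : R) v.-1 = (v == 1%N)%:R.
Proof.
case: v => [|[|v]] //= _; rewrite /binpmf subr0 expr1n mulr1.
  by rewrite bin0 mulr1.
by rewrite expr0n mulr0.
Qed.

(** * The limits for a fixed sample size *)

Section fixed_size_limits.
Context {R : realType} {T : Type} {F : set_system T} {FF : ProperFilter F}.
Variables (m n : nat) (mu0 sigma0 mu sigma : T -> R).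
Context {d : T -> measure_display} {Om : forall t, measurableType (d t)}.
Variables (P : forall t, probability (Om t) R)
  (X : forall t, 'I_n.+1 -> {RV (P t) >-> R}) (i : T -> 'I_m -> 'I_n.+1).
Hypotheses (mn : (m <= n)%N) (n_gt0 : (0 < n)%N).
Hypotheses (sigma0_gt0 : forall t, 0 < sigma0 t)
  (sigma_gt0 : forall t, 0 < sigma t).
Hypothesis sampleX : forall t,
  normal_sample (P t) (X t) (mu0 t) (sigma0 t) (mu t) (sigma t).
Hypotheses (i_inj : forall t, injective (i t))
  (i_neq0 : forall t k, i t k != ord0).
Context {d' : measure_display} {Om' : measurableType d'}
  {P' : probability Om' R}.

Local Notation delta t := ((mu t - mu0 t) / sigma0 t).
Local Notation rho t := (sigma t / sigma0 t).
Local Notation ranks := (fun t w => cons_rV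
  (rank (fun j => X t j : Om t -> R) ord0 w)%:R
  (fun k => (rank (fun j => X t j : Om t -> R) (i t k) w)%:R)).

Lemma cvg_rank_level (z : R) (Y : Om' -> m.+1.-tuple nat) :
  (forall K : R, Phi ((K - delta t) / rho t) @[t --> F] --> z) ->
  (forall c, measurable [set w | Y w = c]) ->
  (forall c, pr P' [set w | Y w = c] =
    if c \in distinct_tuples n.+1 m.+1
    then binpmf n z (tnth c ord0).-1 / (n ^_ m)%:R else 0) ->
  cvg_in_distribution F P ranks P' (fun w => \row_k (tnth (Y w) k)%:R).
Proof.
move=> Fz; apply: (cvg_rank_tuple sigma0_gt0 sigma_gt0 sampleX i_inj i_neq0
  (q := fun v => binpmf n z v.-1)) => v /andP[v0 _].
rewrite -(prednK v0).
exact: (cvg_rank0_binomial sigma0_gt0 sigma_gt0 sampleX Fz).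
Qed.

Lemma cvg_rank_top (U : {RV P' >-> m.-tuple nat}) :
  (forall K : R, Phi ((K - delta t) / rho t) @[t --> F] --> (1 : R)) ->
  uniform_on P' (distinct_tuples n m) U ->
  cvg_in_distribution F P ranks P'
    (fun w => cons_rV n.+1%:R (fun k => (tnth (U w) k)%:R)).
Proof.
move=> F1 uniU.
rewrite (_ : (fun w => cons_rV _ _) =
    (fun w => \row_k (tnth [tuple of n.+1 :: U w] k)%:R)); last first.
  apply/funext => w; apply/rowP => k; rewrite !mxE.
  by case: unliftP => [l ->|->]; rewrite ?tnthS ?tnth0.
apply: (cvg_rank_level (z := 1)) => // c.
  exact: (measurable_tuple_map U (fun u => [tuple of n.+1 :: u])).
rewrite (pr_cons_max uniU); case: ifP => // /mem_distinct_tuples[cb _].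
by rewrite binpmf1.
Qed.

Lemma cvg_rank_bottom (U : {RV P' >-> m.-tuple nat}) :
  (forall K : R, Phi ((K - delta t) / rho t) @[t --> F] --> (0 : R)) ->
  uniform_on P' (distinct_tuples n m) U ->
  cvg_in_distribution F P ranks P'
    (fun w => cons_rV 1 (fun k => 1 + (tnth (U w) k)%:R)).
Proof.
move=> F0 uniU.
rewrite (_ : (fun w => cons_rV _ _) =
    (fun w => \row_k (tnth [tuple of 1%N :: map_tuple S (U w)] k)%:R)); last
      first.
  apply/funext => w; apply/rowP => k; rewrite !mxE.
  by case: unliftP => [l ->|->]; rewrite ?tnthS ?tnth0 ?tnth_map ?nat1r.
apply: (cvg_rank_level (z := 0)) => // c.
  exact: (measurable_tuple_map U (fun u => [tuple of 1%N :: map_tuple S u])).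
rewrite (pr_cons_min uniU); case: ifP => // /mem_distinct_tuples[cb _].
by rewrite binpmf0//; have /andP[] := cb ord0.
Qed.

Lemma cvg_rank_V (z : R) (V : {RV P' >-> m.+1.-tuple nat}) :
  (forall K : R, Phi ((K - delta t) / rho t) @[t --> F] --> z) ->
  V_law P' n z V ->
  cvg_in_distribution F P ranks P' (fun w => \row_k (tnth (V w) k)%:R).
Proof.
move=> Fz lawV; apply: (cvg_rank_level Fz) => c.
  exact: (measurable_tuple_map V id).
exact: pr_V_law.
Qed.

(** The value of [xi] selects between the two extreme limits. *)
Lemma cvg_rank_mixture (delta0 : R) (U : {RV P' >-> m.-tuple nat})
    (xi : {RV P' >-> bool}) :
  (forall t, delta t = delta0) -> (fun t => rho t) @ F --> 0^'+ ->
  uniform_on P' (distinct_tuples n m) U ->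
  has_law P' xi (bernoulli_prob (Phi (- delta0))) ->
  independent2 P' U xi ->
  cvg_in_distribution F P ranks P'
    (fun w => cons_rV (1 + n%:R * (xi w)%:R)
                      (fun k => 1 - (xi w)%:R + (tnth (U w) k)%:R)).
Proof.
move=> deltaE rho0 uniU lawxi indU.
pose top (u : m.-tuple nat) : m.+1.-tuple nat := [tuple of n.+1 :: u].
pose bot (u : m.-tuple nat) : m.+1.-tuple nat := [tuple of 1%N :: map_tuple S
  u].
pose Y w := if xi w then top (U w) else bot (U w).
rewrite (_ : (fun w => cons_rV _ _) = (fun w => \row_k (tnth (Y w) k)%:R)); last
  first.
  apply/funext => w; apply/rowP => k; rewrite !mxE /Y.
  case: (xi w); case: unliftP => [l ->|->]; rewrite /top /bot ?tnthS ?tnth0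
    ?tnth_map.
  - by rewrite subrr add0r.
  - by rewrite mulr1 nat1r.
  - by rewrite subr0 nat1r.
  - by rewrite mulr0 addr0.
have mtop c : measurable [set w | top (U w) = c] by exact: measurable_tuple_map.
have mbot c : measurable [set w | bot (U w) = c] by exact: measurable_tuple_map.
have mxi b : measurable [set w | xi w = b] by rewrite (_ : mkset _ = xi @^-1`
  [set b])//; exact: measurable_funPTI.
have YE c : [set w | Y w = c] =
    ([set w | top (U w) = c] `&` [set w | xi w = true]) `|`
    ([set w | bot (U w) = c] `&` [set w | xi w = false]).
  apply/seteqP; split=> w; rewrite /Y /=.
    by case: (xi w) => H; [left|right].
  by move=> [[H ->]|[H ->]].
have mY c : measurable [set w | Y w = c].
  by rewrite YE; apply: measurableU; exact: measurableI.
apply: (cvg_rank_tuple sigma0_gt0 sigma_gt0 sampleX i_inj i_neq0 (q := fun v =>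
  (v == n.+1)%:R * Phi (- delta0) + (v == 1%N)%:R * (1 - Phi (- delta0)))) => [v
    _||c].
- exact: (cvg_rank0_extreme sigma0_gt0 sigma_gt0 sampleX n_gt0 deltaE rho0).
- exact: mY.
have p01 : 0 <= Phi (- delta0) <= 1 by rewrite Phi_ge0 Phi_le1.
have prxi b : pr P' [set w | xi w = b] = bernoulli_pmf (Phi (- delta0)) b.
  rewrite /pr [P' _](lawxi [set b])// /bernoulli_prob p01.
  by rewrite fsbig_set1.
have ind (h : m.-tuple nat -> m.+1.-tuple nat) b :
    pr P' ([set w | h (U w) = c] `&` [set w | xi w = b]) =
    pr P' [set w | h (U w) = c] * bernoulli_pmf (Phi (- delta0)) b.
  have mh : measurable [set u | h u = c] by exact: measurable_nat_tuples.
  have mhU : measurable [set w | h (U w) = c] by exact: measurable_tuple_map.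
  rewrite -prxi; apply: EFin_inj; rewrite EFinM !prE//; last exact: measurableI.
  exact: (indU [set u | h u = c] [set b]).
rewrite YE pr_setU; first last.
- by move=> w [[_ /= ->] []].
- exact: measurableI.
- exact: measurableI.
rewrite !ind (pr_cons_max uniU) (pr_cons_min uniU); case: ifP => _ /=.
  by rewrite mulrDl mulrAC; congr (_ + _); rewrite mulrAC.
by rewrite !mul0r addr0.
Qed.

End fixed_size_limits.

Theorem theorem3p3 (R : realType)
  (T : Type) (F : set_system T) (FF : ProperFilter F)
  (m : nat) (n : T -> nat) (mu0 sigma0 mu sigma : T -> R)
  (d : T -> measure_display) (Om : forall t, measurableType (d t))
  (P : forall t, probability (Om t) R)
  (X : forall t, 'I_(n t).+1 -> {RV (P t) >-> R})
  (i : forall t, 'I_m -> 'I_(n t).+1)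
  (hm : (1 <= m)%N) (hmn : forall t, (m <= n t)%N)
  (hsigma0 : forall t, 0 < sigma0 t) (hsigma : forall t, 0 < sigma t)
  (hX : forall t, normal_sample (P t) (X t) (mu0 t) (sigma0 t) (mu t) (sigma t))
  (hi1 : forall t k, (1 <= i t k)%N)
  (hi2 : forall t (k l : 'I_m), (k < l)%N -> (i t k < i t l)%N) :
  let delta t := (mu t - mu0 t) / sigma0 t in
  let rho t := sigma t / sigma0 t in
  let rk t (j : 'I_(n t).+1) (w : Om t) : R :=
    (rank (fun j => X t j : Om t -> R) j w)%:R in
  let Rvec t (w : Om t) : 'rV[R]_m.+1 :=
    cons_rV (rk t ord0 w) (fun k => rk t (i t k) w) in
  (forall (n0 : nat) (rho0 : R)
      (d' : measure_display) (Om' : measurableType d') (P' : probability Om' R)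
      (U : {RV P' >-> m.-tuple nat}),
    (forall t, n t = n0) -> (forall t, rho t = rho0) ->
    delta @ F --> -oo%R ->
    uniform_on P' (distinct_tuples n0 m) U ->
    cvg_in_distribution F P Rvec P'
      (fun w => cons_rV n0.+1%:R (fun k => (tnth (U w) k)%:R))) /\
  (forall (n0 : nat) (delta0 : R)
      (d' : measure_display) (Om' : measurableType d') (P' : probability Om' R)
      (U : {RV P' >-> m.-tuple nat}) (xi : {RV P' >-> bool}),
    (forall t, n t = n0) -> (forall t, delta t = delta0) ->
    rho @ F --> 0^'+ ->
    uniform_on P' (distinct_tuples n0 m) U ->
    has_law P' xi (bernoulli_prob (Phi (- delta0))) ->
    independent2 P' U xi ->
    cvg_in_distribution F P Rvec P'
      (fun w => cons_rV (1 + n0%:R * (xi w)%:R)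
                        (fun k => 1 - (xi w)%:R + (tnth (U w) k)%:R))) /\
  (forall (n0 : nat) (rho0 : R)
      (d' : measure_display) (Om' : measurableType d') (P' : probability Om' R)
      (U : {RV P' >-> m.-tuple nat}),
    (forall t, n t = n0) -> (forall t, rho t = rho0) ->
    delta @ F --> +oo%R ->
    uniform_on P' (distinct_tuples n0 m) U ->
    cvg_in_distribution F P Rvec P'
      (fun w => cons_rV 1 (fun k => 1 + (tnth (U w) k)%:R))) /\
  (forall (n0 : nat) (delta0 : R)
      (d' : measure_display) (Om' : measurableType d') (P' : probability Om' R)
      (V : {RV P' >-> m.+1.-tuple nat}),
    (forall t, n t = n0) -> (forall t, delta t = delta0) ->
    rho @ F --> +oo%R ->
    V_law P' n0 (1 / 2) V ->
    cvg_in_distribution F P Rvec P'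
      (fun w => \row_k (tnth (V w) k)%:R)) /\
  (forall (n0 : nat) (r : R)
      (d' : measure_display) (Om' : measurableType d') (P' : probability Om' R)
      (V : {RV P' >-> m.+1.-tuple nat}),
    (forall t, n t = n0) -> (forall t, delta t / rho t = r) ->
    rho @ F --> +oo%R -> (fun t => `|delta t|) @ F --> +oo%R ->
    V_law P' n0 (Phi (- r)) V ->
    cvg_in_distribution F P Rvec P'
      (fun w => \row_k (tnth (V w) k)%:R)) /\
  (* X0' is a variable with the law of X_0 for parameters having the same
     (rho, delta) as the whole family *)
  (forall (mu0' sigma0' mu' sigma' : R)
      (d' : measure_display) (Om' : measurableType d') (P' : probability Om' R)
      (X0' : {RV P' >-> R}) (Y : 'I_m -> {RV P' >-> R}),
    0 < sigma0' -> 0 < sigma' ->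
    (forall t, rho t = sigma' / sigma0') ->
    (forall t, delta t = (mu' - mu0') / sigma0') ->
    n @ F --> \oo ->
    has_law P' X0' (normal_prob mu0' sigma0') ->
    (forall k, has_law P' (Y k) (uniform_prob (@ltr01 R))) ->
    let Z := fun w => Phi ((X0' w - mu') / sigma') in
    mutually_independent P'
      (fun k : option 'I_m => if k is Some l then Y l : Om' -> R else Z) ->
    cvg_in_distribution F P
      (fun t w => (n t)%:R^-1 *: (Rvec t w - const_mx 1)) P'
      (fun w => cons_rV (Z w) (fun k => Y k w))).
Proof.
move=> delta rho rk Rvec.
have i_inj t : injective (i t).
  move=> k l kl; apply/val_inj; case: (ltngtP k l) => // /(hi2 t).
    by rewrite kl ltnn.
  by rewrite kl ltnn.
have i_neq0 t k : i t k != ord0 by rewrite -val_eqE -lt0n hi1.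
have n_gt0 t : (0 < n t)%N := leq_trans hm (hmn t).
have rho_gt0 t : 0 < rho t by rewrite /rho divr_gt0.
(* A proper filter has an inhabited carrier, so the common value of [rho] is
   positive and that of [n] is at least [m]. *)
have [t0 _] := filter_ex (@filterT _ F _).
have rho0_gt0 rho0 : (forall t, rho t = rho0) -> 0 < rho0.
  by move=> rhoE; rewrite -(rhoE t0).
split; last split; last split; last split; last split.
- move=> n0 rho0 d' Om' P' U nE rhoE dl uniU.
  have mn : (m <= n0)%N by rewrite -(nE t0).
  have nE' : n = fun=> n0 by apply/funext.
  subst n; apply: (cvg_rank_top hsigma0 hsigma hX i_inj i_neq0) => // K.
  exact: (cvg_level_delta_ninfty K (rho0_gt0 _ rhoE) rhoE dl).
- move=> n0 delta0 d' Om' P' U xi nE deltaE rl uniU lawxi indU.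
  have mn : (m <= n0)%N by rewrite -(nE t0).
  have n0_gt0 : (0 < n0)%N by rewrite -(nE t0).
  have nE' : n = fun=> n0 by apply/funext.
  subst n.
  exact: (cvg_rank_mixture n0_gt0 hsigma0 hsigma hX i_inj i_neq0 deltaE).
- move=> n0 rho0 d' Om' P' U nE rhoE dl uniU.
  have mn : (m <= n0)%N by rewrite -(nE t0).
  have nE' : n = fun=> n0 by apply/funext.
  subst n; apply: (cvg_rank_bottom hsigma0 hsigma hX i_inj i_neq0) => // K.
  exact: (cvg_level_delta_pinfty K (rho0_gt0 _ rhoE) rhoE dl).
- move=> n0 delta0 d' Om' P' V nE deltaE rl lawV.
  have mn : (m <= n0)%N by rewrite -(nE t0).
  have nE' : n = fun=> n0 by apply/funext.
  subst n; apply: (cvg_rank_V mn hsigma0 hsigma hX i_inj i_neq0 (z := 1 / 2)) =>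
    // K.
  rewrite -Phi0 -oppr0; apply: cvg_level_rho_pinfty => //.
  rewrite (_ : (fun t => _) = (fun t => delta0 * (rho t)^-1)); last first.
    by apply/funext => t; rewrite -(deltaE t).
  rewrite -[0](mulr0 delta0); apply: cvgM; first exact: cvg_cst.
  by apply/gtr0_cvgV0 => //; near=> t; exact: rho_gt0.
- move=> n0 r d' Om' P' V nE deltaE rl _ lawV.
  have mn : (m <= n0)%N by rewrite -(nE t0).
  have nE' : n = fun=> n0 by apply/funext.
  subst n; apply: (cvg_rank_V mn hsigma0 hsigma hX i_inj i_neq0 (z := Phi (-
    r))) => // K.
  apply: cvg_level_rho_pinfty => //.
  by rewrite (funext deltaE); exact: cvg_cst.
- move=> mu0' sigma0' mu' sigma' d' Om' P' X0' Y s0' s' rhoE deltaE nl lX lY Z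
  indZY.
  exact: (@cvg_rescaled_ranks R T F FF m n mu0 sigma0 mu sigma d Om P X i
    hsigma0 hsigma n_gt0 hX i_inj i_neq0 mu0' sigma0' mu' sigma' d' Om' P' X0' Y
    s0' s' rhoE deltaE nl lX lY indZY).
Unshelve. all: end_near. Qed.
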